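(* Let $M$ be a compact Riemannian manifold and let $\phi_0:M\to\mathbb{R}$ be continuous. Then there exists a dense subset $\mathcal{A}$ of $\mathrm{End}(M)$ such that for every $f\in\mathcal{A}$ there exists a $\phi_0$-maximizing measure for $f$ which is supported on a periodic orbit of $f$.
   Context: $\mathrm{End}(M)$ denotes the set of continuous surjections $f:M\to M$, endowed with the $\mathcal{C}^0$ metric $d(f,g)=\sup_{x\in M}d(f(x),g(x))$, where $d$ on the right-hand side is the distance on $M$. For $f\in\mathrm{End}(M)$, $\mathcal{M}_{inv}(f)$ is the set of $f$-invariant Borel probability measures on $M$. A measure $\mu\in\mathcal{M}_{inv}(f)$ is called $\phi_0$-maximizing (for $f$) if $\int\phi_0\,d\mu=\sup_{\nu\in\mathcal{M}_{inv}(f)}\int\phi_0\,d\nu$. *)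

(* Defs.v *)
From HB Require Import structures.
From mathcomp Require Import all_boot all_order all_algebra.
From mathcomp Require Import all_classical all_reals all_analysis.

Set Implicit Arguments.
Unset Strict Implicit.
Unset Printing Implicit Defensive.

Import Order.TTheory GRing.Theory Num.Theory.
Import numFieldNormedType.Exports.

Local Open Scope classical_set_scope.
Local Open Scope ring_scope.

(* The point is needed both for the Borel sigma-algebra below, since measurable
   types are pointed, and to exclude the empty manifold, which carries no
   probability measure. *)
#[short(type="pmetricType")]
HB.structure Definition PointedMetric (R : realType) :=
  {M of Pointed M & Metric R M}.

(* The intended use is with V finite dimensional and U open: all iterated
   directional derivatives of order at most k exist and are continuous on U. *)
Fixpoint Ck (R : realType) (V W : normedModType R) (k : nat) (U : set V)
    (f : V -> W) : Prop :=
  (forall x, U x -> {for x, continuous f}) /\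
  if k is k'.+1 then
    forall v, (forall x, U x -> derivable f x v) /\ Ck k' U ('D_v f)
  else True.

Definition smooth (R : realType) (V W : normedModType R) (U : set V)
    (f : V -> W) : Prop :=
  forall k, Ck k U f.

(* [dom i] and [chart i @` dom i] are open and [param i] is the inverse of
   [chart i] between them; both maps are total, with irrelevant values outside
   these sets. The topology of M is that of its metric, so it is Hausdorff, and
   second countable as soon as M is compact. *)
Record smoothAtlas (R : realType) (n : nat) (M : pmetricType R) := SmoothAtlas {
  chart_idx : Type ;
  dom : chart_idx -> set M ;
  chart : chart_idx -> M -> 'rV[R]_n ;
  param : chart_idx -> 'rV[R]_n -> M ;
  chart_at : M -> chart_idx ;
  open_dom : forall i, open (dom i) ;
  open_cod : forall i, open (chart i @` dom i) ;
  chartK : forall i x, dom i x -> param i (chart i x) = x ;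
  chart_continuous : forall i x, dom i x -> {for x, continuous (chart i)} ;
  param_continuous : forall i u, (chart i @` dom i) u ->
    {for u, continuous (param i)} ;
  dom_chart_at : forall x, dom (chart_at x) x ;
  transition_smooth : forall i j,
    smooth (chart i @` (dom i `&` dom j)) (chart j \o param i)
}.

Definition bilin (R : realType) (n : nat) (G : 'M[R]_n) (v w : 'rV[R]_n) : R :=
  (v *m G *m w^T) 0 0.

(* A Riemannian metric in local coordinates: [gram i u] is the Gram matrix of
   the inner product of the tangent space at [param i u], in the coordinate
   basis of the chart i. *)
Record riemannianMetric (R : realType) (n : nat) (M : pmetricType R)
    (A : smoothAtlas n M) := RiemannianMetric {
  gram : chart_idx A -> 'rV[R]_n -> 'M[R]_n ;
  gram_smooth : forall i, smooth (chart i @` dom i) (gram i) ;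
  gram_sym : forall i u, (chart i @` dom i) u -> (gram i u)^T = gram i u ;
  gram_pos : forall i u v, (chart i @` dom i) u -> v != 0 ->
    0 < bilin (gram i u) v v ;
  gram_transition : forall i j x v w, dom i x -> dom j x ->
    bilin (gram i (chart i x)) v w =
    bilin (gram j (chart j x)) ('D_v (chart j \o param i) (chart i x))
                               ('D_w (chart j \o param i) (chart i x))
}.

Section riemannian_distance.
Context (R : realType) (n : nat) (M : pmetricType R) (A : smoothAtlas n M).
Variable g : riemannianMetric A.

Definition smooth_curve (c : R -> M) : Prop :=
  continuous c /\
  forall i : chart_idx A,
    smooth ((c @^-1` dom i) : set R^o) (chart i \o c : R^o -> 'rV[R]_n).

Definition speed (c : R -> M) (t : R) : R :=
  let i := chart_at A (c t) in
  let v := derive1 (chart i \o c : R -> 'rV[R]_n) t in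
  Num.sqrt (bilin (gram g i (chart i (c t))) v v).

Definition curve_length (c : R -> M) : R :=
  (\int[@lebesgue_measure R]_(t in `[0, 1]) speed c t)%R.

(* [path_length x y l] says that l is the length of some piecewise smooth path
   from x to y, i.e. of a concatenation of smooth segments. A smooth segment is
   the restriction to [0, 1] of a smooth curve defined on the whole line: up to
   this extension these are the curves smooth on [0, 1] up to the endpoints. *)
Inductive path_length (x : M) : M -> R -> Prop :=
| path_length_refl : path_length x x 0
| path_length_cat (l : R) (c : R -> M) :
    path_length x (c 0) l -> smooth_curve c ->
    path_length x (c 1) (l + curve_length c).

(* M is not assumed connected: between points that no path joins, [mdist] is
   only required to be compatible with the topology of M. *)
Definition riemannian_distance : Prop :=
  forall x y : M, path_length x y !=set0 -> mdist x y = inf (path_length x y).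

End riemannian_distance.

Notation borel M := (g_sigma_algebraType (@open M)).

Section endomorphisms.
Context (R : realType) (M : pmetricType R).

Definition End : set (M -> M) :=
  [set f | continuous f /\ set_surj [set: M] [set: M] f].

Definition C0dist (f g : M -> M) : R :=
  sup [set mdist (f x) (g x) | x in [set: M]].

Definition dense_in_End (D : set (M -> M)) : Prop :=
  D `<=` End /\
  forall f, End f -> forall e : R, 0 < e -> exists2 g, D g & C0dist f g < e.

Definition invariant_measures (f : M -> M) : set (probability (borel M) R) :=
  [set mu | forall B : set (borel M), measurable B -> mu (f @^-1` B) = mu B].

Definition maximizing (phi : M -> R) (f : M -> M)
    (mu : probability (borel M) R) : Prop :=
  invariant_measures f mu /\
  (\int[mu]_x (phi x)%:E =
   ereal_sup [set \int[nu]_x (phi x)%:E | nu in invariant_measures f])%E.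

Definition periodic_orbit (f : M -> M) (O : set M) : Prop :=
  exists x p,
    [/\ (0 < p)%N, iter p f x = x & O = [set iter k f x | k in [set: nat]]].

Definition supported_on (mu : probability (borel M) R) (S : set (borel M)) : Prop :=
  measurable S /\ mu (~` S) = 0%E.

End endomorphisms.

(* Main.v *)
(**
  The integral of phi against any f-invariant measure is at most the maximal
  rate beta(f), the infimum of the m such that S_n phi <= n m + C along all
  orbits. It is therefore enough to find g close to f with a periodic orbit of
  mean beta(g).

  Closing: for every d > 0 some orbit segment returns within d of its starting
  point with mean at least beta(f). If no d-return has mean above beta(f), a
  modification of f in a tiny ball that closes such a segment creates a periodic
  orbit of mean beta(f), and all new excursions are d-returns of f, so the
  maximal rate does not grow.

  Otherwise there is a d-return t, ..., x whose mean is strictly above beta(f).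
  Long orbit segments have mean below any threshold exceeding beta(f), so the
  return times that matter are now bounded, and on a short path from f(x) to t
  there is a first point whose orbit hits x with mean above the threshold. Let
  g send x to this point t', and the points at distance a from x to the point of parameter chi(a) of the
  path, with chi(0) = 1. An excursion from distance a to distance a' exceeds the
  mean m of the new periodic orbit by an amount that tends to 0 with a', and has
  a definite deficit if it hits x from an earlier point of the path. If chi
  decreases fast enough near 0, excursions without a deficit end much farther
  from x than they start, and the excess is dominated by the increment of a
  bounded potential psi(distance to x). Hence beta(g) = m. The image of the ball
  is still covered because an outer ring is stretched over the whole ball.
*)
Require Import Defs.
From HB Require Import structures.
From mathcomp Require Import all_boot all_order all_algebra.
From mathcomp Require Import all_classical all_reals all_analysis.
From mathcomp Require Import finmap measurable_realfun ring lra zify.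
Import Order.TTheory GRing.Theory Num.Theory.
Import numFieldNormedType.Exports.
Local Open Scope classical_set_scope.
Local Open Scope ring_scope.

Set Implicit Arguments.
Unset Strict Implicit.
Unset Printing Implicit Defensive.

(** * Compactness, Birkhoff sums and the maximal rate *)

(** Finitely many neighbourhoods cover [K], and by monotonicity in [n] the largest of their indices
    serves everywhere. *)
Lemma compact_near_nat (T : topologicalType) (K : set T)
    (P : nat -> T -> Prop) : compact K ->
  (forall n n' z, (n <= n')%N -> P n z -> P n' z) ->
  (forall z, K z -> exists n, \forall z' \near z, P n z') ->
  exists n, forall z, K z -> P n z.
Proof.
move=> /compact_near_coveringP cK Pmono Ploc.
have := cK nat \oo (fun n z => P n z) _.
case=> [z Kz|n _ Pn].
  have [n Pn] := Ploc z Kz.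
  exists ((fun z' => P n z'), [set n' | (n <= n')%N]).
    by split => //=; exists n.
  by move=> [z' n'] /= [Pz' nn']; exact: Pmono nn' Pz'.
by exists n; apply: Pn => /=.
Qed.

Lemma compact_near_pos (R : realType) (T : topologicalType) (K : set T)
    (P : R -> T -> Prop) : compact K ->
  (forall r r' z, r' <= r -> P r z -> P r' z) ->
  (forall z, K z -> exists2 r, 0 < r & \forall z' \near z, P r z') ->
  exists2 r, 0 < r & forall z, K z -> P r z.
Proof.
move=> cK Pmono Ploc.
have [] := @compact_near_nat T K (fun n z => P n.+1%:R^-1 z) cK.
- move=> n n' z nn'; apply: Pmono.
  by rewrite lef_pV2 ?posrE// ler_nat.
- move=> z /Ploc[r r0 Pr]; exists (Num.truncn r^-1).
  apply: filterS Pr => z'; apply: Pmono.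
  rewrite -[leRHS]invrK lef_pV2 ?posrE ?invr_gt0//.
  exact/ltW/truncnS_gt.
by move=> n Pn; exists n.+1%:R^-1 => //; rewrite invr_gt0.
Qed.

Section birkhoff_sums.
Context {R : realType} {M : ptopologicalType}.
Implicit Types (f : M -> M) (phi : M -> R).

Definition birkhoff f phi n y : R := \sum_(i < n) phi (iter i f y).

Lemma birkhoffD f phi m n y :
  birkhoff f phi (m + n) y = birkhoff f phi m y + birkhoff f phi n (iter m f y).
Proof.
rewrite /birkhoff big_split_ord/=; congr (_ + _).
by apply: eq_bigr => i _; rewrite addnC iterD.
Qed.

Lemma birkhoff_periodic f phi p j y : iter p f y = y ->
  birkhoff f phi (j * p) y = j%:R * birkhoff f phi p y.
Proof.
move=> fpy; elim: j => [|j IHj]; first by rewrite mul0n mul0r /birkhoff big_ord0.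
by rewrite mulSn birkhoffD fpy IHj mulrS mulrDl mul1r.
Qed.

Lemma continuous_iter f n : continuous f -> continuous (iter n f).
Proof.
move=> cf; elim: n => [|n IHn] x /=; first exact: cvg_id.
exact: (continuous_comp (IHn x) (cf _)).
Qed.

Lemma continuous_birkhoff f phi n : continuous f -> continuous phi ->
  continuous (birkhoff f phi n).
Proof.
move=> cf cphi; elim: n => [|n IHn] x.
  rewrite (_ : birkhoff f phi 0 = cst 0); first exact: cvg_cst.
  by apply/funext => y; rewrite /birkhoff big_ord0.
rewrite (_ : birkhoff f phi n.+1 = birkhoff f phi n \+ (phi \o iter n f)).
  apply: continuousD; first exact: IHn.
  apply: continuous_comp; first exact: continuous_iter.
  exact: cphi.
by apply/funext => y; rewrite /birkhoff big_ord_recr.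
Qed.

(* Every invariant measure then integrates [phi] to at most [m]. *)
Definition upper_rate f phi (m : R) :=
  exists C, forall n y, birkhoff f phi n y <= n%:R * m + C.

(** For continuous data on a compact metric space this is the maximal ergodic average, the largest
    integral of [phi] against an invariant measure. *)
Definition max_rate f phi := inf [set m | upper_rate f phi m].

Lemma upper_rate_le f phi m m' :
  m <= m' -> upper_rate f phi m -> upper_rate f phi m'.
Proof.
move=> mm' [C Cm]; exists C => n y.
by rewrite (le_trans (Cm n y))// lerD2r ler_wpM2l.
Qed.

Lemma continuous_bounded phi : compact [set: M] -> continuous phi ->
  exists2 L, 0 < L & forall y, `|phi y| <= L.
Proof.
move=> cM cphi.
have [] := @compact_near_nat M setT (fun n z => `|phi z| < n%:R) cM.
- by move=> n n' z nn' /lt_le_trans; apply; rewrite ler_nat.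
- move=> z _; exists (Num.truncn `|phi z|).+1.
  have : (fun z' => `|phi z'|) @ z --> `|phi z|.
    by apply: continuous_comp; [exact: cphi|exact: norm_continuous].
  by move/cvgr_lt; apply; exact: truncnS_gt.
move=> n nphi; exists n.+1%:R => // y.
by rewrite (le_trans (ltW (nphi y I)))// ler_nat.
Qed.

Lemma birkhoff_ge f phi L n y : (forall y, `|phi y| <= L) ->
  - (n%:R * L) <= birkhoff f phi n y.
Proof.
move=> phiL; rewrite /birkhoff mulr_natl -[n in L *+ n]card_ord -sumr_const -sumrN.
apply: ler_sum => i _.
by have := phiL (iter i f y); rewrite ler_norml => /andP[].
Qed.

Lemma birkhoff_le f phi L n y : (forall y, `|phi y| <= L) ->
  birkhoff f phi n y <= n%:R * L.
Proof.
move=> phiL; rewrite /birkhoff mulr_natl -[n in L *+ n]card_ord -sumr_const.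
apply: ler_sum => i _.
by have := phiL (iter i f y); rewrite ler_norml => /andP[].
Qed.

Lemma linear_bound_le (a b C : R) : (forall n : nat, n%:R * a <= n%:R * b + C) -> a <= b.
Proof.
move=> ab; rewrite leNgt; apply/negP => ba.
have ab0 : 0 < a - b by rewrite subr_gt0.
have := truncnS_gt (C / (a - b)); rewrite ltr_pdivrMr//.
by have := ab (Num.truncn (C / (a - b))).+1; lra.
Qed.

Lemma has_inf_upper_rate f phi L : (forall y, `|phi y| <= L) ->
  has_inf [set m | upper_rate f phi m].
Proof.
move=> phiL; split.
  by exists L, 0 => n y; rewrite addr0 birkhoff_le.
exists (- L) => m [C Cm]; apply: (@linear_bound_le _ _ C) => n.
by rewrite (le_trans _ (Cm n point))// mulrN birkhoff_ge.
Qed.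

Lemma upper_rate_gt f phi L m : (forall y, `|phi y| <= L) ->
  max_rate f phi < m -> upper_rate f phi m.
Proof.
move=> phiL; rewrite -subr_gt0 => /inf_adherent.
move=> /(_ _ (has_inf_upper_rate f phiL))[m' + /ltW].
by rewrite addrC subrK => fm' mm'; exact: upper_rate_le fm'.
Qed.

Lemma max_rate_le f phi L m : (forall y, `|phi y| <= L) ->
  upper_rate f phi m -> max_rate f phi <= m.
Proof. by move=> phiL; apply: ge_inf; exact: (has_inf_upper_rate f phiL).2. Qed.

(** Going [j] times around the cycle multiplies the sum by [j], while the additive constant of an
    upper rate stays fixed. *)
Lemma periodic_le_max_rate f phi L p y : (forall y, `|phi y| <= L) ->
  iter p f y = y -> birkhoff f phi p y <= p%:R * max_rate f phi.
Proof.
move=> phiL fpy; have [->|p0] := posnP p; first by rewrite /birkhoff big_ord0 mul0r.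
have p0' : 0 < p%:R :> R by rewrite ltr0n.
rewrite mulrC -ler_pdivrMr//; apply/ler_addgt0Pl => e e0.
have [C Cm] : upper_rate f phi (e + max_rate f phi).
  by apply: upper_rate_gt phiL _; rewrite ltrDr.
rewrite ler_pdivrMr//; apply: (@linear_bound_le _ _ C) => j.
by rewrite -birkhoff_periodic// (le_trans (Cm _ _))// natrM -mulrA (mulrC p%:R).
Qed.

(** An orbit is cut greedily into blocks of length at most [N]; only the last, incomplete block
    contributes to the constant. *)
Lemma upper_rate_blocks f phi L N m : (forall y, `|phi y| <= L) ->
  (forall y, exists k, [/\ (0 < k)%N, (k <= N)%N &
    birkhoff f phi k y <= k%:R * m]) -> upper_rate f phi m.
Proof.
move=> phiL blocks; exists (N%:R * (L + `|m|)) => n.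
have L0 : 0 <= L by rewrite (le_trans _ (phiL point)).
elim/ltn_ind: n => n IHn y.
have [nN|Nn] := leqP n N.
  rewrite (le_trans (birkhoff_le _ _ _ phiL))//.
  have : n%:R * (L + `|m|) <= N%:R * (L + `|m|).
    by rewrite ler_wpM2r ?ler_nat// addr_ge0.
  have : n%:R * - m <= n%:R * `|m| by rewrite ler_wpM2l// -normrN ler_norm.
  by rewrite mulrDr; lra.
have [k [k0 kN Sk]] := blocks y.
have kn : (k <= n)%N by lia.
rewrite -(subnKC kn) birkhoffD natrD mulrDl -addrA lerD// IHn//.
by rewrite ltn_subrL k0 (leq_ltn_trans _ Nn).
Qed.

(** Otherwise every point starts a block of mean below the maximal rate. By compactness the block
    lengths are bounded and the gap is uniform, so the blocks yield a smaller upper rate. *)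
Lemma exists_orbit_ge_max_rate f phi : compact [set: M] -> continuous f ->
  continuous phi ->
  exists x, forall n, n%:R * max_rate f phi <= birkhoff f phi n x.
Proof.
move=> cM cf cphi; have [L L0 phiL] := continuous_bounded cM cphi.
apply: contrapT => /forallNP nx.
set b := max_rate f phi in nx.
(* One index bounds both the block length and the inverse of the gap, which makes the condition
   monotone. *)
have [] := @compact_near_nat M setT (fun N y => exists k, [/\ (0 < k)%N,
  (k <= N.+1)%N & birkhoff f phi k y < k%:R * (b - N.+1%:R^-1)]) cM.
- move=> n n' z nn' [k [k0 kn Sk]]; exists k; split => //.
    exact: leq_trans kn _.
  apply: (lt_le_trans Sk); rewrite ler_wpM2l// lerD2l lerN2.
  by rewrite lef_pV2 ?posrE// ler_nat.
- move=> z _; have /existsNP[k /negP] := nx z; rewrite -ltNge => Sk.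
  have k0 : (0 < k)%N.
    by case: k Sk => //; rewrite mul0r /birkhoff big_ord0 ltxx.
  have k0' : 0 < k%:R :> R by rewrite ltr0n.
  pose e := b - birkhoff f phi k z / k%:R.
  have e0 : 0 < e by rewrite subr_gt0 ltr_pdivrMr// mulrC.
  pose N := maxn k (Num.truncn e^-1).
  exists N.
  have Ne : N.+1%:R^-1 < e.
    rewrite -[ltRHS]invrK ltf_pV2 ?posrE ?invr_gt0//.
    rewrite (lt_le_trans (truncnS_gt _))// ler_nat ltnS; exact: leq_maxr.
  have Sk' : birkhoff f phi k z < k%:R * (b - N.+1%:R^-1).
    by rewrite mulrC -ltr_pdivrMr// ltrBrDr addrC -ltrBrDr.
  move: (@continuous_birkhoff f phi k cf cphi z) => /cvgr_lt /(_ _ Sk').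
  apply: filterS => z' /= ?.
  exists k; split => //; rewrite ltnW// ltnS; exact: leq_maxl.
move=> N blocks.
have : upper_rate f phi (b - N.+1%:R^-1).
  apply: (@upper_rate_blocks _ _ L N.+1) => // y.
  by have [k [? ? /ltW ?]] := blocks y I; exists k.
move/(max_rate_le phiL); rewrite -/b lerBrDl gerDr.
by rewrite leNgt invr_gt0 ltr0n.
Qed.

End birkhoff_sums.

(** * Closing orbit segments *)

Lemma finite_near_pos (R : realType) (P : R -> nat -> Prop) (N : nat) :
  (forall r r' k, r' <= r -> P r k -> P r' k) ->
  (forall k, (k <= N)%N -> exists2 r, 0 < r & P r k) ->
  exists2 r, 0 < r & forall k, (k <= N)%N -> P r k.
Proof.
move=> Pmono; elim: N => [|N IHN] PN.
  have [r r0 Pr] := PN 0%N (leqnn _).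
  by exists r => // k; rewrite leqn0 => /eqP ->.
have [r r0 Pr] := IHN (fun k kN => PN k (leqW kN)).
have [r' r'0 Pr'] := PN N.+1 (leqnn _).
exists (Num.min r r') => [|k]; first by rewrite lt_min r0 r'0.
rewrite leq_eqVlt => /predU1P[->|]; first by apply: Pmono Pr'; rewrite ge_min lexx orbT.
by rewrite ltnS => /Pr; apply: Pmono; rewrite ge_min lexx.
Qed.

Section closing.
Context {R : realType} {M : pmetricType R}.
Implicit Types (f : M -> M) (phi : M -> R).

Lemma near_mdist_lt (T : topologicalType) (f : T -> M) (z : T) (e : R) :
  {for z, continuous f} -> 0 < e -> \forall y \near z, mdist (f z) (f y) < e.
Proof.
by move=> fz e0; have := fz _ (nbhsx_ballx _ _ e0); rewrite ballEmdist.
Qed.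

Lemma mdist_continuous (T : topologicalType) (f g : T -> M) (z : T) :
  {for z, continuous f} -> {for z, continuous g} ->
  {for z, continuous (fun y => mdist (f y) (g y) : R)}.
Proof.
move=> cf cg; apply/cvgrPdist_lt => e e0.
have e20 : 0 < e / 2 by rewrite divr_gt0.
apply: filterS2 (near_mdist_lt cf e20) (near_mdist_lt cg e20) => y fy gy.
rewrite ltr_norml.
have := metric_triangle (f z) (f y) (g z).
have := metric_triangle (f y) (g y) (g z).
have := metric_triangle (f y) (f z) (g y).
have := metric_triangle (f z) (g z) (g y).
rewrite (metric_sym (f y) (f z)) (metric_sym (g y) (g z)); lra.
Qed.

(** Each point is assigned to one centre of a finite cover by balls of radius [d / 2]. The cells
    serve for a pigeonhole argument on return times. *)
Lemma compact_finite_cells (d : R) : compact [set: M] -> 0 < d ->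
  exists (N : nat) (c : M -> 'I_N),
    forall y z, c y = c z -> mdist y z < d.
Proof.
move=> cM d0; have d20 : 0 < d / 2 by rewrite divr_gt0.
move: cM; rewrite compact_cover => /(_ M setT (fun z => (ball z (d / 2))^°)).
case=> [z _||D _ DM]; first exact: open_interior.
  by move=> y _; exists y => //; exact: nbhsx_ballx.
have /choice[c cP] : forall y, exists z : D, ball (val z) (d / 2) y.
  move=> y; have [z zD /interior_subset zy] := DM y I.
  by exists [` zD]%fset.
exists #|{: D}|, (fun y => enum_rank (c y)) => y z /enum_rank_inj cyz.
have := cP z; have := cP y; rewrite cyz !ballEmdist/= => cy cz.
rewrite (le_lt_trans (metric_triangle y (val (c z)) z))//.
by rewrite (splitr d) ltrD// metric_sym.
Qed.

(** Along an orbit whose excess [D] over the maximal rate stays nonnegative, a failure of the claim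
    makes [D] drop at every return to a cell, and by at least a fixed [e] if the return time is at
    most [N]. Late drops within a cell are smaller than [e], yet returns of time at most [N] keep
    occurring. *)
Lemma exists_closing_orbit f phi (d : R) : compact [set: M] -> continuous f ->
    continuous phi -> 0 < d ->
  exists v l, [/\ (0 < l)%N, mdist (iter l f v) v < d &
    l%:R * max_rate f phi <= birkhoff f phi l v].
Proof.
move=> cM cf cphi d0; set b := max_rate f phi.
have [x xb] := exists_orbit_ge_max_rate cM cf cphi.
have d20 : 0 < d / 2 by rewrite divr_gt0.
have [N [c cP]] := compact_finite_cells cM d20.
pose D n := birkhoff f phi n x - n%:R * b.
have D0 n : 0 <= D n by rewrite subr_ge0.
have DB i l : birkhoff f phi l (iter i f x) - l%:R * b = D (i + l)%N - D i.
  by rewrite /D birkhoffD natrD; ring.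
pose cell n := c (iter n f x).
have cell_dist i l : cell (i + l)%N = cell i ->
    mdist (iter l f (iter i f x)) (iter i f x) < d / 2.
  by move=> ?; rewrite -iterD addnC; exact: cP.
apply: contrapT => noclosing.
have Ddecr i l : (0 < l)%N -> cell (i + l)%N = cell i -> D (i + l)%N < D i.
  move=> l0 il; rewrite ltNge; apply/negP => Dil; apply: noclosing.
  exists (iter i f x), l; split => //.
    by have := cell_dist _ _ il; lra.
  by rewrite -subr_ge0 DB subr_ge0.
have [e e0 eP] : exists2 e, 0 < e & forall l, (l <= N)%N -> forall p, setT p ->
    (0 < l)%N -> mdist (iter l f p) p < d / 2 ->
    birkhoff f phi l p - l%:R * b <= - e.
  apply: finite_near_pos.
    move=> r r' l rr' H p pT l0 pd; apply: le_trans (H p pT l0 pd) _.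
    by rewrite lerN2.
  move=> l lN; apply: (compact_near_pos cM).
    by move=> r r' z rr' H l0 zd; apply: le_trans (H l0 zd) _; rewrite lerN2.
  (* A point not returning within [d] has neighbours not returning within [d / 2], for which the
     claim is vacuous. Hence the cells of size [d / 2]. *)
  move=> p _; have [dp|pd] := leP d (mdist (iter l f p) p).
    exists 1 => //.
    have : {for p, continuous (fun z => mdist (iter l f z) z : R)}.
      by apply: mdist_continuous; [exact: continuous_iter|exact: cvg_id].
    have dp2 : d / 2 < mdist (iter l f p) p by lra.
    move=> /cvgr_gt/(_ _ dp2).
    by apply: filterS => z zd _ dz; have := lt_trans zd dz; rewrite ltxx.
  have [->|l0] := posnP l.
    by exists 1 => //; apply: nearW.
  have Sp : birkhoff f phi l p - l%:R * b < 0.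
    rewrite ltNge subr_ge0; apply/negP => Sl; apply: noclosing.
    by exists p, l.
  pose r := - (birkhoff f phi l p - l%:R * b) / 2.
  exists r; first by rewrite /r; lra.
  have : birkhoff f phi l @ p --> birkhoff f phi l p.
    exact: continuous_birkhoff.
  have Sr : birkhoff f phi l p < l%:R * b - r by rewrite /r; lra.
  move=> /cvgr_lt/(_ _ Sr).
  by apply: filterS => z zd _ _; lra.
(* On each cell [D] is decreasing and nonnegative, so its late drops are small. *)
have small_drops i0 : exists T, forall i l, (T <= i)%N -> (0 < l)%N ->
    cell i = i0 -> cell (i + l)%N = i0 -> D i - D (i + l)%N < e.
  pose V := [set D n | n in [set n | cell n = i0]].
  have [V0|/set0P V0] := eqVneq V set0.
    exists 0%N => i l _ _ ii0; suff : V (D i) by rewrite V0.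
    by exists i.
  have infV : has_inf V.
    by split => //; exists 0 => _ [n _ <-].
  have [_ [T Ti0 <-] DT] := inf_adherent e0 infV.
  exists T => i l Ti l0 ii0 ili0.
  have : inf V <= D (i + l)%N by apply: ge_inf; [exact: infV.2|exists (i + l)%N].
  suff : D i <= D T by lra.
  have [->//|iT] := eqVneq i T.
  have := @Ddecr T (i - T)%N; rewrite subnKC// subn_gt0 ltn_neqAle eq_sym iT Ti.
  by rewrite Ti0 ii0 => /(_ isT erefl)/ltW.
have [T TP] := choice small_drops.
pose T0 := (\max_i T i)%N.
(* Among [N.+1] consecutive times beyond all thresholds, two lie in the same one of the [N]
   cells. *)
have /injectivePn[i [j ij cij]] : ~~ injectiveb (fun i : 'I_N.+1 => cell (T0 + i)%N).
  by apply/negP => /injectiveP/leq_card; rewrite !card_ord ltnn.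
wlog {ij} ij : i j cij / (i < j)%N.
  move=> W; have : (i != j :> nat) by [].
  by rewrite neq_ltn => /orP[]; exact: W.
pose l := (j - i)%N.
have jE : (T0 + j)%N = (T0 + i + l)%N by rewrite /l; lia.
have l0 : (0 < l)%N by rewrite subn_gt0.
have lN : (l <= N)%N by rewrite /l; have := ltn_ord j; lia.
have T0i : (T (cell (T0 + i)) <= T0 + i)%N.
  exact: leq_trans (leq_bigmax _) (leq_addr _ _).
have cji : cell (T0 + i + l)%N = cell (T0 + i)%N by rewrite -jE.
have := eP l lN (iter (T0 + i) f x) I l0 (cell_dist _ _ cji).
by have := TP _ _ l T0i l0 erefl cji; rewrite DB; lra.
Qed.

End closing.

(** * Return maps of a local modification *)

Section return_map.
Context {R : realType} {M : ptopologicalType}.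
Variables (f g : M -> M) (phi : M -> R) (U : set M).
Hypothesis fg : forall y, ~ U y -> g y = f y.

Lemma iter_outside j t : (forall i, (i < j)%N -> ~ U (iter i f t)) ->
  forall i, (i <= j)%N -> iter i g t = iter i f t.
Proof.
move=> nU; elim=> [//|i IHi] ij /=.
have ij' := ltnW ij; rewrite (IHi ij'); apply: fg; exact: nU.
Qed.

Lemma iter_outside_periodic k t : (forall i, (i < k)%N -> ~ U (iter i f t)) ->
  g (iter k f t) = t -> iter k.+1 g t = t.
Proof. by move=> nU gt; rewrite iterS (iter_outside nU). Qed.

(** A sum of [j.+1] terms applies the map only [j] times, so the point at time [j] may already lie
    in [U]. *)
Lemma birkhoff_outside j t : (forall i, (i < j)%N -> ~ U (iter i f t)) ->
  birkhoff g phi j.+1 t = birkhoff f phi j.+1 t.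
Proof.
move=> nU; apply: eq_bigr => i _.
by rewrite (iter_outside nU)// -ltnS.
Qed.

Lemma first_visit n t : (forall i, (i < n)%N -> ~ U (iter i f t)) \/
  exists j, [/\ (j < n)%N, U (iter j f t) &
    forall i, (i < j)%N -> ~ U (iter i f t)].
Proof.
elim: n => [|n [nU|[j [jn Uj nU]]]]; first by left.
- have [Un|nUn] := pselect (U (iter n f t)); first by right; exists n.
  by left=> i; rewrite ltnS leq_eqVlt => /predU1P[->//|]; exact: nU.
- by right; exists j; split => //; exact: ltnW.
Qed.

(* The potential [psi] bounds the excess of each excursion from [U] back to [U],
   so that the excesses telescope along an orbit of [g]. *)
Lemma upper_rate_return (psi : M -> R) (P m : R) : upper_rate f phi m -> 0 <= P ->
  (forall y, U y -> 0 <= psi y <= P) ->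
  (forall y k, U y -> U (iter k f (g y)) ->
    birkhoff f phi k.+1 (g y) <= k.+1%:R * m + psi (iter k f (g y)) - psi y) ->
  upper_rate g phi m.
Proof.
move=> [C fC] P0 psiP ret.
have C0 : 0 <= C by have := fC 0%N point; rewrite /birkhoff big_ord0 mul0r add0r.
(* Induction over successive visits: each excursion trades its excess for an increment of [psi], and
   the last stretch without a visit costs [C]. *)
have inside n y : U y ->
    birkhoff g phi n (g y) <= n%:R * m + C + P - psi y.
  elim/ltn_ind: n y => n IHn y Uy; have /andP[_ yP] := psiP _ Uy.
  have [nU|[j [jn Uj nU]]] := first_visit n (g y).
    case: n {IHn} nU => [_|n nU].
      by rewrite /birkhoff big_ord0 mul0r; lra.
    rewrite birkhoff_outside; last by move=> i ?; exact/nU/ltnW.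
    by have := fC n.+1 (g y); lra.
  rewrite -(subnKC jn) birkhoffD birkhoff_outside// iterS.
  rewrite (iter_outside nU)// natrD mulrDl.
  have := ret _ _ Uy Uj.
  have := IHn (n - j.+1)%N _ _ Uj; rewrite ltn_subrL (leq_ltn_trans _ jn)// => /(_ isT).
  lra.
(* One [C] pays for the stretch up to the first visit, [C + P] for what follows. *)
exists (C + C + P) => n z.
have [nU|[j [jn Uj nU]]] := first_visit n z.
  case: n nU => [_|n nU].
    by rewrite /birkhoff big_ord0; lra.
  rewrite birkhoff_outside; last by move=> i ?; exact/nU/ltnW.
  by have := fC n.+1 z; lra.
rewrite -(subnKC jn) birkhoffD birkhoff_outside// iterS.
rewrite (iter_outside nU)// natrD mulrDl.
have := fC j.+1 z; have := inside (n - j.+1)%N _ Uj; have := psiP _ Uj.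
lra.
Qed.

End return_map.

(** * Invariant measures on periodic orbits *)

Section orbit_measure.
Context d (T : measurableType d) (R : realType) (x : nat -> T) (n : nat).

(** The points may repeat, and [n] stands for [n.+1] of them, so that the mass can be normalised. *)
Definition uniform_measure : set T -> \bar R :=
  mscale (n.+1%:R^-1)%:nng (msum (fun i => \d_(x i)) n.+1).

HB.instance Definition _ := Measure.on uniform_measure.

Let uniform_measure_setT : uniform_measure setT = 1%E.
Proof.
rewrite /uniform_measure /mscale/= /msum.
rewrite (eq_bigr (fun=> 1%E)) => [|i _]; last exact: diracT.
by rewrite sumEFin sumr_const card_ord -EFinM mulVf// pnatr_eq0.
Qed.

HB.instance Definition _ :=
  Measure_isProbability.Build _ _ _ uniform_measure uniform_measure_setT.

Lemma ge0_integral_uniform_measure (h : T -> R) : measurable_fun setT h ->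
  (forall y, 0 <= h y) ->
  (\int[uniform_measure]_y (h y)%:E =
  (n.+1%:R^-1 * \sum_(i < n.+1) h (x i))%R%:E)%E.
Proof.
move=> /measurable_EFinP mh h0.
have h0' (y : T) : setT y -> (0 <= (h y)%:E)%E by rewrite lee_fin.
rewrite ge0_integral_mscale// ge0_integral_measure_sum//.
under eq_bigr => i _ do rewrite integral_dirac// diracT mul1e.
by rewrite sumEFin -EFinM.
Qed.

End orbit_measure.

Section maximizing_periodic.
Context {R : realType} {M : pmetricType R}.
Variables (g : M -> M) (phi : M -> R).
Hypotheses (cg : continuous g) (cphi : continuous phi).

Lemma continuous_borel_measurable (h : M -> R) : continuous h ->
  measurable_fun setT (h : borel M -> R).
Proof.
move=> /continuousP ch; apply: (measurability _ (RGenOpens.measurableE R)).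
move=> _ [_ [a [b ->] <-]]; rewrite setTI; apply: sub_sigma_algebra.
exact/ch/interval_open.
Qed.

Lemma continuous_borel_measurable_self (h : M -> M) : continuous h ->
  measurable_fun setT (h : borel M -> borel M).
Proof.
move=> /continuousP ch; apply: (@measurability _ _ (borel M) (borel M) setT h (@open M)) => //.
by move=> _ [B oB <-]; rewrite setTI; apply: sub_sigma_algebra; exact: ch.
Qed.

Lemma invariant_measure_iter (nu : probability (borel M) R) n
    (B : set (borel M)) : invariant_measures g nu -> measurable B ->
  nu (iter n g @^-1` B) = nu B.
Proof.
move=> nug mB; elim: n => [//|n IHn].
rewrite -[RHS]IHn -[RHS]nug; last first.
  rewrite -[X in measurable X]setTI.
  exact: (continuous_borel_measurable_self (continuous_iter (n := n) cg)).
by congr (nu _); apply/seteqP; split => y /=; rewrite -iterSr.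
Qed.

Variable L : R.
Hypothesis phiL : forall y, `|phi y| <= L.

Let phi_shift_ge0 y : 0 <= phi y + L.
Proof. by have := phiL y; rewrite ler_norml => /andP[]; lra. Qed.

Let mphi_shift : measurable_fun setT ((fun y => phi y + L) : borel M -> R).
Proof.
apply: continuous_borel_measurable => y.
by apply: continuousD; [exact: cphi|exact: cvg_cst].
Qed.

(** Adding [L] makes the integrand nonnegative, so that sums and pushforwards are handled by
    integrals of nonnegative functions. *)
Lemma integral_shift (nu : probability (borel M) R) :
  (\int[nu]_y (phi y)%:E = \int[nu]_y (phi y + L)%:E - L%:E)%E.
Proof.
have icst (r : R) : nu.-integrable setT (EFin \o cst r).
  exact: finite_measure_integrable_cst.
have iphi : nu.-integrable setT (EFin \o (phi : borel M -> R)).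
  apply: measurable_bounded_integrable => //.
  - by rewrite (le_lt_trans (probability_le1 _ _))// ltry.
  - exact: continuous_borel_measurable.
  - by exists L; split => [|r Lr y _ /=]; [exact: num_real|rewrite (le_trans (phiL y))// ltW].
transitivity (\int[nu]_y ((phi y)%:E + L%:E) - L%:E)%E; last first.
  by congr (_ - _)%E; apply: eq_integral => y _; rewrite EFinD.
rewrite (integralD _ iphi (icst L))//= integral_cst//.
by rewrite [X in (L%:E * X)%E]probability_setT mule1 addeK.
Qed.

(** By invariance, [n] times the integral is the integral of a Birkhoff sum of length [n], which the
    rate bounds pointwise; the constant disappears after division by [n]. *)
Lemma integral_invariant_le (nu : probability (borel M) R) m :
  invariant_measures g nu -> upper_rate g phi m ->
  (\int[nu]_y (phi y + L)%:E <= (m + L)%:E)%E.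
Proof.
move=> nug [C gC].
set I := (\int[nu]_y (phi y + L)%:E)%E.
have I0 : (0 <= I)%E by apply: integral_ge0 => y _; rewrite lee_fin.
have nI n : (n%:R%:E * I <= (n%:R * (m + L) + C)%:E)%E.
  have C0 : 0 <= C by have := gC 0%N point; rewrite /birkhoff big_ord0 mul0r add0r.
  have mi (i : nat) : measurable_fun setT
      ((fun y => phi (iter i g y) + L) : borel M -> R).
    apply: continuous_borel_measurable => y.
    apply: continuousD; last exact: cvg_cst.
    by apply: continuous_comp; [exact: continuous_iter|exact: cphi].
  have -> : (n%:R%:E * I = \int[nu]_y (\sum_(i < n) (phi (iter i g y) + L)%:E))%E.
    rewrite mule_natl ge0_integral_sum//.
    - rewrite (eq_bigr (fun=> I)).
        by rewrite sumr_const card_ord.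
      move=> i _.
      have mgi := continuous_borel_measurable_self
        (continuous_iter (n := i) cg).
      have := @ge0_integral_pushforward _ _ _ _ R _ mgi nu setT
        (fun y => (phi y + L)%:E) measurableT.
      rewrite preimage_setT /comp => <-.
      - apply: eq_measure_integral => A mA _.
        exact: (invariant_measure_iter i nug mA).
      - exact/measurable_EFinP.
      - by move=> y _; rewrite lee_fin.
    - by move=> i; exact/measurable_EFinP.
    - by move=> i y _; rewrite lee_fin.
  have <- : (\int[nu]_y cst (n%:R * (m + L) + C)%:E y = (n%:R * (m + L) + C)%:E)%E.
    by rewrite integral_cst// [X in (_ * X)%E]probability_setT mule1.
  apply: ge0_le_integral => //.
  - by move=> y _; apply: sume_ge0 => i _; rewrite lee_fin.
  - by apply: emeasurable_sum => i; exact/measurable_EFinP.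
  - move=> y _; rewrite sumEFin lee_fin big_split/= sumr_const card_ord.
    by have := gC n y; rewrite /birkhoff mulrDr -mulr_natl; lra.
have Ifin : I \is a fin_num.
  rewrite ge0_fin_numE//; have := nI 1%N; rewrite mul1e => /le_lt_trans; apply.
  exact: ltry.
rewrite -(fineK Ifin) lee_fin; apply: (@linear_bound_le _ _ _ C) => n.
by have := nI n; rewrite -(fineK Ifin) -EFinM lee_fin.
Qed.

(** The uniform measure on the cycle integrates [phi] to at least [m], any invariant measure to at
    most each [m' > m]. The bounds are asked above [m] only, the form in which an infimum of rates
    provides them. *)
Lemma exists_maximizing_periodic m x k : (0 < k)%N -> iter k g x = x ->
  k%:R * m <= birkhoff g phi k x ->
  (forall m', m < m' -> upper_rate g phi m') ->
  exists2 mu : probability (borel M) R, maximizing phi g mu &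
    exists2 O : set M, periodic_orbit g O & supported_on mu O.
Proof.
case: k => // k _ gkx km rate.
pose xs (i : nat) : borel M := iter i g x.
pose mu : probability (borel M) R := uniform_measure R xs k.
pose O : set M := [set iter i g x | i in [set: nat]].
have muE B : mu B = ((k.+1%:R^-1)%:E * \sum_(i < k.+1) \d_(xs i) B)%E by [].
have mO : measurable (O : set (borel M)).
  have -> : O = \bigcup_(i in setT) [set iter i g x].
    apply/seteqP; split => [_ [i _ <-]|y [i _ ->]]; by exists i.
  apply: bigcup_measurable => i _; rewrite -[X in measurable X]setCK.
  apply: measurableC; apply: sub_sigma_algebra; apply: closed_openC.
  apply: accessible_closed_set1; apply: hausdorff_accessible.
  exact: metric_hausdorff.
have mu_inv : invariant_measures g mu.
  move=> B mB; rewrite !muE; congr (_ * _)%E.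
  (* The preimage shifts the sum by one index, and its last term becomes the first because the orbit
     closes up. *)
  rewrite big_ord_recr big_ord_recl/= addeC; congr (_ + _)%E.
  by rewrite !diracE/= -[in RHS]gkx; congr (_%:R%:E); rewrite !mem_setE/= asboolE.
exists mu; last first.
  exists O; first by exists x, k.+1.
  split => //; rewrite muE big1 ?mule0// => i _.
  by rewrite diracE memNset//= => /(_ _)[]; exists i.
split => //.
have mu_ge : (\int[mu]_y (phi y + L)%:E >= (m + L)%:E)%E.
  rewrite ge0_integral_uniform_measure// lee_fin ler_pdivlMl ?ltr0n//.
  rewrite big_split/= sumr_const card_ord -(mulr_natl L) mulrDr.
  by rewrite lerD2r.
apply/eqP; rewrite eq_le; apply/andP; split.
  by apply: ereal_sup_ubound; exists mu.
apply: ge_ereal_sup => _ [nu nug <-].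
rewrite !integral_shift leeD2r//; apply: le_trans mu_ge.
have mL' (m' : R) : m < m' -> (\int[nu]_y (phi y + L)%:E <= (m' + L)%:E)%E.
  by move=> /rate; exact: integral_invariant_le.
apply/lee_addgt0Pr => e e0; rewrite -EFinD.
have := mL' (m + e); rewrite ltrDl e0 => /(_ isT).
by rewrite addrAC.
Qed.

End maximizing_periodic.

(** * Vanishing majorants and profiles *)

Section majorant.
Context {R : realType} {T : Type}.
Variables (Z : set T) (s a : T -> R) (L : R).

(* The infimum of the affine functions [e + K e * x] lying above the points
   [(a z, s z)] is concave, hence continuous. *)
Lemma exists_vanishing_majorant :
  (forall z, Z z -> s z <= L) ->
  (forall e, 0 < e -> exists2 r, 0 < r & forall z, Z z -> a z <= r -> s z <= e) ->
  exists w : R -> R, [/\ continuous w, w 0 = 0, forall x, 0 <= w x,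
    forall x y, x <= y -> w x <= w y & forall z, Z z -> 0 <= a z -> s z <= w (a z)].
Proof.
move=> sL vanish.
have /choice[r rP] : forall e, exists r, 0 < e ->
    0 < r /\ forall z, Z z -> a z <= r -> s z <= e.
  move=> e; have [/vanish[r r0 rP]|e0] := ltP 0 e; first by exists r.
  by exists 0.
(* With this slope the line [e + K e * x] lies above [e] for [x >= 0] and above [L] for
   [x >= r e]. *)
pose K e := Num.max L 0 / r e.
have K0 e : 0 < e -> 0 <= K e.
  by move=> /rP[r0 _]; apply: divr_ge0; [rewrite le_max lexx orbT|exact: ltW].
pose S x := [set e + K e * x | e in [set e | 0 < e]].
pose v x := inf (S x).
have Sinf x : 0 <= x -> has_inf (S x).
  move=> x0; split; first by exists (1 + K 1 * x), 1 => //=.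
  by exists 0 => _ [e /= e0 <-]; apply: addr_ge0; [exact: ltW|rewrite mulr_ge0// K0].
have v_le x e : 0 <= x -> 0 < e -> v x <= e + K e * x.
  by move=> x0 e0; apply: ge_inf; [exact: (Sinf x x0).2|exists e].
have le_v x c : 0 <= x -> (forall e, 0 < e -> c <= e + K e * x) -> c <= v x.
  move=> x0 cS; apply: lb_le_inf; first exact: (Sinf x x0).1.
  by move=> _ [e e0 <-]; exact: cS.
have v0 x : 0 <= x -> 0 <= v x.
  by move=> x0; apply: le_v => // e e0; apply: addr_ge0; [exact: ltW|rewrite mulr_ge0// K0].
have v00 : v 0 = 0.
  apply/eqP; rewrite eq_le v0// andbT; apply/ler_addgt0Pr => e e0.
  by rewrite add0r (le_trans (v_le 0 e _ e0))// mulr0 addr0.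
have v_mono x y : 0 <= x -> x <= y -> v x <= v y.
  move=> x0 xy; apply: le_v => [|e e0]; first exact: le_trans xy.
  by rewrite (le_trans (v_le x e x0 e0))// lerD2l ler_wpM2l ?K0.
(* The quotient [v x / x] is nonincreasing: this is all that is used of concavity. *)
have v_scale x y : 0 < x -> x <= y -> x * v y <= y * v x.
  move=> x0 xy; have y0 : 0 < y by exact: lt_le_trans xy.
  suff : x / y * v y <= v x by rewrite mulrAC ler_pdivrMr// [v x * y]mulrC.
  apply: le_v => [|e e0]; first exact: ltW.
  have xy1 : 0 <= x / y <= 1.
    by rewrite divr_ge0 ?(ltW x0) ?(ltW y0)//= ler_pdivrMr// mul1r.
  rewrite (le_trans (ler_wpM2l _ (v_le y e (ltW y0) e0)))//.
    by case/andP: xy1.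
  rewrite mulrDr [_ * (K e * y)]mulrCA divfK ?gt_eqF// lerD2r.
  by apply: ler_piMl; [exact: ltW|case/andP: xy1].
have max0 (x : R) : 0 <= Num.max x 0 by rewrite le_max lexx orbT.
exists (fun x => v (Num.max x 0)); split.
- move=> x; apply/cvgrPdist_lt => e e0.
  set x' := Num.max x 0.
  have cmax : {for x, continuous (fun y : R => Num.max y 0)}.
    by apply: continuous_max; [exact: cvg_id|exact: cvg_cst].
  (* A line almost attaining the infimum at [x'] bounds [v] from above nearby; monotonicity and
     [v_scale] bound it from below. *)
  have [_ [d d0 <-] dv] : exists2 t, S x' t & t < v x' + e / 2.
    apply: inf_adherent; [exact: divr_gt0|exact/Sinf/max0].
  have cK : {for x, continuous (fun y : R => v x' + e / 2 - (d + K d * Num.max y 0))}.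
    apply: continuousB; first exact: cvg_cst.
    apply: continuousD; first exact: cvg_cst.
    by apply: continuousM; [exact: cvg_cst|exact: cmax].
  have near1 : \forall y \near x, 0 < v x' + e / 2 - (d + K d * Num.max y 0).
    by apply: (cvgr_gt _ cK); rewrite subr_gt0.
  have [x'0|x'0] := leP x' 0.
    have x'E : x' = 0 by apply/eqP; rewrite eq_le x'0 max0.
    apply: filterS near1 => y; rewrite x'E v00 sub0r normrN ger0_norm ?v0//.
    by have := v_le (Num.max y 0) d (max0 y) d0; lra.
  have c2 : {for x, continuous (fun y : R => e * x' - (x' - Num.max y 0) * v x')}.
    apply: continuousB; first exact: cvg_cst.
    apply: continuousM; last exact: cvg_cst.
    by apply: continuousB; [exact: cvg_cst|exact: cmax].
  have near2 : \forall y \near x, 0 < e * x' - (x' - Num.max y 0) * v x'.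
    by apply: (cvgr_gt _ c2); rewrite subrr mul0r subr0 mulr_gt0.
  have near3 : \forall y \near x, 0 < Num.max y 0 by exact: (cvgr_gt _ cmax).
  apply: filterS3 near1 near2 near3 => y y1 y2 y3; rewrite ltr_norml.
  have := v_le (Num.max y 0) d (max0 y) d0.
  have [x'y|yx'] := leP x' (Num.max y 0).
    by have := v_mono _ _ (max0 x) x'y; lra.
  have vyx : v x' - v (Num.max y 0) < e.
    rewrite -(ltr_pM2r x'0).
    by have := v_scale _ _ y3 (ltW yx'); lra.
  by have := v_mono _ _ (max0 y) (ltW yx'); lra.
- by rewrite maxxx.
- by move=> x; exact: v0.
- move=> x y xy; apply: v_mono => //.
  by rewrite ge_max !le_max xy lexx/= orbT.
- move=> z Zz az; rewrite max_l//; apply: le_v => // e e0.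
  have [r0 re] := rP e e0.
  have [ar|ra] := leP (a z) (r e).
    by rewrite (le_trans (re z Zz ar))// lerDl mulr_ge0// K0.
  rewrite (le_trans (sL z Zz))// (@le_trans _ _ (K e * a z))//; last first.
    by rewrite lerDr ltW.
  rewrite /K mulrAC ler_pdivlMr//.
  apply: (@le_trans _ _ (Num.max L 0 * r e)).
    by apply: ler_wpM2r; [exact: ltW|rewrite le_max lexx].
  by apply: ler_wpM2l; [exact: max0|exact: ltW].
Qed.

End majorant.

(** Since [E] is bounded below by a positive constant on [[0, 1 - e]], the parameters [l] with
    [E k l < psi x] approach 1 as [x] tends to 0. A vanishing majorant of [1 - l] shows how far
    below 1 the value [chi x] must be to avoid them. *)
Lemma exists_profile (R : realType) (N : nat) (E : nat -> R -> R)
    (psi : R -> R) (u : R) : 0 < u ->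
  (forall k, (k <= N)%N -> continuous (E k)) ->
  (forall k l, (k <= N)%N -> 0 <= l -> l < 1 -> 0 < E k l) ->
  (forall e, 0 < e -> exists2 r, 0 < r & psi r <= e) ->
  (forall x y, x <= y -> psi x <= psi y) ->
  (forall k, (k <= N)%N -> psi u <= E k 0) ->
  exists chi : R -> R, [/\ continuous chi, chi 0 = 1, chi u = 0,
    forall x, 0 <= chi x <= 1 &
    forall x, 0 < x -> x <= u ->
      chi x < 1 /\ forall k, (k <= N)%N -> psi x <= E k (chi x)].
Proof.
move=> u0 cE E_gt0 psi0 psi_mono psiu.
(* A pair is [(1 - l, x)] with [l] forbidden at [x]. *)
pose Z := [set z : R * R | 0 <= z.1 <= 1 /\
  exists2 k, (k <= N)%N & E k (1 - z.1) < psi z.2].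
have [] := @exists_vanishing_majorant R (R * R)%type Z fst snd 1.
- by move=> z [/andP[]].
- move=> e e0; have [e1|e1] := leP 1 e.
    by exists 1 => // z [/andP[_ z1] _] _; exact: le_trans e1.
  have [c c0 cP] : exists2 c, 0 < c & forall k, (k <= N)%N ->
      forall l, `[0, 1 - e]%classic l -> c <= E k l.
    apply: finite_near_pos => [r r' k rr' H l le|k kN].
      exact: le_trans rr' (H l le).
    apply: (compact_near_pos (segment_compact (a := 0) (b := 1 - e))).
      by move=> r r' l; exact: le_trans.
    move=> l /=; rewrite in_itv/= => /andP[l0 l1].
    have El : 0 < E k l by apply: E_gt0 => //; lra.
    exists (E k l / 2); first by rewrite divr_gt0.
    have El2 : E k l / 2 < E k l by lra.
    have := cE k kN l; move=> /cvgr_gt/(_ _ El2).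
    by apply: filterS => z /ltW.
  have [r r0 rc] := psi0 c c0; exists r => // z [z01 [k kN Ez]] zr.
  rewrite leNgt; apply/negP => ez.
  have := cP k kN (1 - z.1); rewrite /= in_itv/= subr_ge0 lerD2l lerN2.
  rewrite (ltW ez); case/andP: z01 => _ -> /(_ isT).
  by have := psi_mono _ _ zr; lra.
move=> w [cw w0 w_ge0 w_mono wZ].
(* The term in [x / u] puts [d] strictly above the majorant for [x > 0], as long as [d x < 1], and
   makes [d u] equal to 1. *)
pose d x := Num.min 1 (w x + Num.max x 0 / u).
exists (fun x => 1 - d x); split.
- move=> x; apply: continuousB; first exact: cvg_cst.
  apply: continuous_min; first exact: cvg_cst.
  apply: continuousD; first exact: cw.
  apply: continuousM; last exact: cvg_cst.
  by apply: continuous_max; [exact: cvg_id|exact: cvg_cst].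
- by rewrite /d w0 maxxx mul0r addr0 min_r// subr0.
- by rewrite /d max_l ?(ltW u0)// divff ?gt_eqF// min_l ?subrr// lerDr.
- move=> x; rewrite subr_ge0 ge_min lexx/= gerBl le_min ler01/=.
  by rewrite addr_ge0// divr_ge0 ?(ltW u0)// le_max lexx orbT.
- move=> x x0 xu.
  have xu0 : 0 < x / u by rewrite divr_gt0.
  have d0 : 0 < d x.
    by rewrite lt_min ltr01/= max_l ?(ltW x0)// ltr_wpDl.
  split => [|k kN]; first by rewrite ltrBlDr ltrDl.
  have [d1|d1] := leP 1 (d x).
    have -> : 1 - d x = 0.
      by apply/eqP; rewrite subr_eq0 eq_le d1/= ge_min lexx.
    exact: le_trans (psi_mono _ _ xu) (psiu k kN).
  rewrite leNgt; apply/negP => Ek.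
  have : Z (d x, x).
    by split => /=; [rewrite (ltW d0) (ltW d1)|exists k].
  move=> /wZ/(_ (ltW x0))/=; move: d1.
  rewrite /d; rewrite max_l ?(ltW x0)//.
  by have [h|h] := leP 1 (w x + x / u); lra.
Qed.

(** * Surgery in a chart *)

Section charts.
Context {R : realType} {n : nat} {M : pmetricType R}.
Variable A : smoothAtlas n M.

(** The chart at [x] is cut down to the preimage [W] of a ball around [c x], since the constructions
    below use convexity and radial scaling. *)
Lemma exists_local_chart (x : M) : exists (c : M -> 'rV[R]_n) (p : 'rV[R]_n -> M),
  exists2 r0 : R, 0 < r0 & exists W : set M, [/\ open W, W x,
    forall y, W y -> [/\ p (c y) = y, `|c y - c x| < r0 & {for y, continuous c}] &
    forall w, `|w - c x| < r0 -> [/\ W (p w), c (p w) = w & {for w, continuous p}]].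
Proof.
pose i := chart_at A x; exists (chart i), (param i).
have dx : dom i x by exact: dom_chart_at.
have codx : nbhs (chart i x) (chart i @` dom i).
  by apply: open_nbhs_nbhs; split; [exact: open_cod|exists x].
have [r0 /= r00 cod_r0] := (nbhs_ballP _ _).1 codx.
exists r0 => //.
exists (dom i `&` [set y | `|chart i y - chart i x| < r0]); split.
- rewrite openE => y [dy yr0]; apply: filterI.
    by apply: open_nbhs_nbhs; split => //; exact: open_dom.
  have : {for y, continuous (fun z => `|chart i z - chart i x|)}.
    apply: continuous_comp; last exact: norm_continuous.
    by apply: continuousB; [exact: chart_continuous|exact: cvg_cst].
  by move=> /cvgr_lt/(_ _ yr0).
- by split => //=; rewrite subrr normr0.
- move=> y [dy yr0]; split => //; first exact: chartK.
  exact: chart_continuous.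
- move=> w wr0.
  have [y dy yw] : (chart i @` dom i) w.
    by apply: cod_r0; rewrite -ball_normE /= distrC.
  have pwy : param i w = y by rewrite -yw chartK.
  split; first by split; rewrite pwy//= yw.
    by rewrite pwy.
  by apply: param_continuous; exists y.
Qed.

(** Nearby points are joined by a straight segment in a chart ball, which is convex; compactness
    makes the distance uniform. *)
Lemma small_paths (e : R) : compact [set: M] -> 0 < e ->
  exists2 d : R, 0 < d & forall p q : M, mdist p q < d ->
    exists G : R -> M, [/\ continuous G, G 0 = p, G 1 = q &
      forall l, mdist p (G l) < e].
Proof.
move=> cM e0.
have [] := @compact_near_pos R M setT (fun d p => forall q, mdist p q < d ->
    exists G : R -> M, [/\ continuous G, G 0 = p, G 1 = q &
      forall l, mdist p (G l) < e]) cM.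
- by move=> r r' z rr' H q zq; apply: H; exact: lt_le_trans rr'.
- move=> x _.
  have [c [p [r0 r00 [W [oW Wx WP pP]]]]] := exists_local_chart x.
  have [pcx _ cx] := WP x Wx.
  have e20 : 0 < e / 2 by rewrite divr_gt0.
  have cxr0 : `|c x - c x| < r0 by rewrite subrr normr0.
  have [_ _ cp] := pP _ cxr0.
  have [r1 /= r10 r1P] := (nbhs_ballP _ _).1 (near_mdist_lt cp e20).
  pose r := Num.min r0 r1.
  have r_gt0 : 0 < r by rewrite lt_min r00 r10.
  have near_x : \forall y \near x, W y /\ `|c y - c x| < r.
    apply: filterI; first exact: open_nbhs_nbhs.
    have : {for x, continuous (fun z => `|c z - c x|)}.
      apply: continuous_comp; last exact: norm_continuous.
      by apply: continuousB; [exact: cx|exact: cvg_cst].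
    by move=> /cvgr_lt; apply; rewrite subrr normr0.
  have [d /= d0 dP] := (nbhs_ballP _ _).1 near_x.
  have d20 : 0 < d / 2 by rewrite divr_gt0.
  exists (d / 2) => //.
  have := nbhsx_ballx x _ d20; rewrite !ballEmdist in dP *.
  apply: filterS => y /= xy q yq.
  have [Wy cyr] : W y /\ `|c y - c x| < r by apply: dP => /=; lra.
  have [Wq cqr] : W q /\ `|c q - c x| < r.
    by apply: dP => /=; have := metric_triangle x y q; lra.
  have [pcy _ _] := WP y Wy; have [pcq _ _] := WP q Wq.
  (* Clamping the parameter makes the path constant outside [[0, 1]], hence defined on the whole
     line. *)
  pose t (l : R) := Num.max 0 (Num.min 1 l).
  pose w l := c y + t l *: (c q - c y).
  have t01 l : 0 <= t l <= 1.
    by rewrite /t le_max lexx/= ge_max ler01 ge_min lexx.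
  have wr l : `|w l - c x| < r.
    have -> : w l - c x = (1 - t l) *: (c y - c x) + t l *: (c q - c x).
      by rewrite /w !scalerBr !scalerBl !scale1r; apply/rowP => j; rewrite !mxE; ring.
    have /andP[t0 t1] := t01 l.
    rewrite (le_lt_trans (ler_normD _ _))// !normrZ !ger0_norm ?subr_ge0//.
    have [->|tl0] := eqVneq (t l) 0; first by rewrite subr0 mul1r mul0r addr0.
    have tl_gt0 : 0 < t l by rewrite lt_neqAle eq_sym tl0.
    have : (1 - t l) * `|c y - c x| <= (1 - t l) * r.
      by rewrite ler_wpM2l ?subr_ge0// ltW.
    have : t l * `|c q - c x| < t l * r by rewrite ltr_pM2l.
    by lra.
  have wr0 l : `|w l - c x| < r0 by rewrite (lt_le_trans (wr l))// ge_min lexx.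
  exists (p \o w); split.
  + move=> l; apply: continuous_comp; last by have [] := pP _ (wr0 l).
    apply: continuousD; first exact: cvg_cst.
    apply: continuousZl => //.
    apply: continuous_max; first exact: cvg_cst.
    by apply: continuous_min; [exact: cvg_cst|exact: cvg_id].
  + by rewrite /= /w /t min_r// maxxx scale0r addr0.
  + by rewrite /= /w /t minxx max_r// scale1r addrC subrK.
  + move=> l; have xG : mdist x (p (w l)) < e / 2.
      rewrite -[in mdist x _]pcx; apply: r1P; rewrite -ball_normE /= distrC.
      by rewrite (lt_le_trans (wr l))// ge_min lexx orbT.
    have xy2 : mdist x y < e / 2.
      rewrite -[in mdist x _]pcx -[y]pcy; apply: r1P; rewrite -ball_normE /= distrC.
      by rewrite (lt_le_trans cyr)// ge_min lexx orbT.
    by have := metric_triangle y x (p (w l)); rewrite (metric_sym y x)/=; lra.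
by move=> d d0 dP; exists d => // p q; exact: dP.
Qed.

End charts.

(** * Crushing a ball while keeping surjectivity *)

Section surgery.
Context {R : realType} {n : nat} {M : pmetricType R}.
Variable A : smoothAtlas n M.

(** The factor scaling a vector of norm [t]: it collapses norms up to [u / 2], sends [t] in
    [[u / 2, u]] to [2 * t - u] and fixes the rest. The inner maximum keeps the denominator
    positive. *)
Definition ring_stretch (u t : R) := Num.min 1 (2 - u / Num.max t (u / 2)).

Lemma ring_stretch_bounds u t : 0 < u -> 0 <= ring_stretch u t <= 1.
Proof.
move=> u0; rewrite le_min ler01 ge_min lexx !andbT/=.
have m0 : 0 < Num.max t (u / 2) by rewrite lt_max divr_gt0 ?orbT.
by rewrite subr_ge0 ler_pdivrMr// mulrC -ler_pdivrMr// le_max lexx orbT.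
Qed.

Lemma ring_stretch_in u t : 0 < u -> t <= u / 2 -> ring_stretch u t = 0.
Proof.
move=> u0 tu; rewrite /ring_stretch max_r// invf_div mulrCA divff ?gt_eqF//.
by rewrite mulr1 subrr min_r.
Qed.

Lemma ring_stretch_out u t : 0 < u -> u <= t -> ring_stretch u t = 1.
Proof.
move=> u0 ut; have t0 : 0 < t by exact: lt_le_trans ut.
rewrite /ring_stretch max_l; last by lra.
rewrite min_l// lerBrDl -lerBrDr; have : u / t <= 1 by rewrite ler_pdivrMr// mul1r.
by lra.
Qed.

Lemma ring_stretch_mid u t : 0 < u -> u / 2 <= t -> t <= u ->
  ring_stretch u t * t = 2 * t - u.
Proof.
move=> u0 ut tu; have t0 : 0 < t by apply: lt_le_trans ut; rewrite divr_gt0.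
rewrite /ring_stretch max_l// min_r.
  by rewrite mulrBl divfK// gt_eqF.
have : 1 <= u / t by rewrite ler_pdivlMr// mul1r.
by lra.
Qed.

Lemma ring_stretch_continuous u : 0 < u -> continuous (ring_stretch u).
Proof.
move=> u0 t.
change {for t, continuous (fun t => Num.min 1 (2 - u / Num.max t (u / 2)))}.
apply: continuous_min; first exact: cvg_cst.
apply: continuousB; first exact: cvg_cst.
apply: continuousM; first exact: cvg_cst.
apply: continuousV; first by rewrite gt_eqF// lt_max divr_gt0 ?orbT.
by apply: continuous_max; [exact: cvg_id|exact: cvg_cst].
Qed.

(** Here [rho] is the chart distance to [x], constantly [r0] off the chart ball. The map [h] crushes
    the inner half ball to [x] and stretches the surrounding ring over the whole ball, which keeps
    it surjective. *)
Lemma exists_radial_crush (x : M) : compact [set: M] -> (0 < n)%N ->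
  exists (rho : M -> R), exists2 r0, 0 < r0 &
  [/\ continuous rho, rho x = 0, forall y, 0 <= rho y, forall y, rho y = 0 -> y = x &
    forall V, nbhs x V -> exists2 u, 0 < u & forall y, rho y <= u -> V y] /\
  forall u, 0 < u -> u < r0 -> exists h : M -> M,
    [/\ continuous h, forall y, u <= rho y -> h y = y,
      forall y, rho y <= u / 2 -> h y = x,
      forall y, rho y <= u -> rho (h y) <= u &
      forall z, exists2 y, u / 2 <= rho y & h y = z].
Proof.
move=> cM n0.
have [c [p [r0 r00 [W [oW Wx WP pP]]]]] := exists_local_chart A x.
pose rho y := if pselect (W y) then `|c y - c x| else r0.
have rhoW y : W y -> rho y = `|c y - c x| by rewrite /rho; case: pselect.
have rhoN y : ~ W y -> rho y = r0 by rewrite /rho; case: pselect.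
have rho_lt y : rho y < r0 <-> W y.
  split=> [|Wy]; last by rewrite rhoW//; have [] := WP y Wy.
  by have [//|nWy] := pselect (W y); rewrite rhoN// ltxx.
have rho_le y : rho y <= r0.
  by have [Wy|nWy] := pselect (W y); [exact/ltW/rho_lt|rewrite rhoN].
have rho_p w : `|w - c x| < r0 -> rho (p w) = `|w - c x|.
  by move=> /pP[Wp cp _]; rewrite rhoW// cp.
have [pcx _ cx] := WP x Wx.
have crho : continuous rho.
  move=> y; have [Wy|nWy] := pselect (W y).
    have cy : {for y, continuous (fun z => `|c z - c x|)}.
      have [_ _ cy] := WP y Wy.
      apply: continuous_comp; last exact: norm_continuous.
      by apply: continuousB; [exact: cy|exact: cvg_cst].
    rewrite /continuous_at rhoW//; apply: cvg_trans cy.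
    apply: near_eq_cvg; have : nbhs y W by exact: open_nbhs_nbhs.
    by apply: filterS => z Wz; rewrite rhoW.
  (* Off [W], the points with [rho <= r0 - e] lie in the image of a compact ball, a closed set that
     misses [y]. *)
  apply/cvgrPdist_lt => e e0; rewrite rhoN//.
  pose B := closed_ball_ (fun w : 'rV[R]_n => `|w|) (c x) (r0 - e).
  have Br0 w : B w -> `|w - c x| < r0.
    by rewrite /B /closed_ball_/= distrC; lra.
  have cK : closed (p @` B).
    apply: compact_closed; first exact: metric_hausdorff.
    apply: continuous_compact.
      apply: continuous_in_subspaceT => w /set_mem /Br0/pP[_ _ //].
    apply: bounded_closed_compact; last exact: closed_closed_ball_.
    exists (`|c x| + (r0 - e)); split => [|m mB w /= Bw]; first exact: num_real.
    apply: le_trans (ltW mB); rewrite -[w](subrK (c x)) addrC.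
    rewrite (le_trans (ler_normD _ _))// lerD2l.
    by move: Bw; rewrite /B /closed_ball_/= distrC.
  have : nbhs y (~` (p @` B)).
    apply: open_nbhs_nbhs; split; first exact: closed_openC.
    by move=> [w /Br0/pP[Wp _ _] pwy]; apply: nWy; rewrite -pwy.
  apply: filterS => z nKz; have rz := rho_le z.
  rewrite ger0_norm ?subr_ge0// ltrBlDr -ltrBlDl ltNge; apply/negP => zr.
  have Wz : W z by apply/rho_lt; lra.
  have [pcz _ _] := WP z Wz; apply: nKz; exists (c z) => //.
  by rewrite /B /closed_ball_/= distrC -rhoW.
have rho_ge0 y : 0 <= rho y.
  by have [Wy|nWy] := pselect (W y); [rewrite rhoW|rewrite rhoN// ltW].
exists rho, r0 => //; split.
  split => //.
  - by rewrite rhoW// subrr normr0.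
  - move=> y ry0; have Wy : W y by apply/rho_lt; rewrite ry0.
    move: ry0; rewrite rhoW// => /normr0_eq0/eqP; rewrite subr_eq0 => /eqP cyx.
    by have [<- _ _] := WP y Wy; rewrite cyx.
  - move=> V Vx.
    have cxr0 : `|c x - c x| < r0 by rewrite subrr normr0.
    have [_ _ cp] := pP _ cxr0.
    have : nbhs (c x) (p @^-1` V) by apply: cp; rewrite pcx.
    move=> /(nbhs_ballP _ _).1 [d /= d0 dV].
    exists (Num.min r0 d / 2); first by rewrite divr_gt0// lt_min r00 d0.
    move=> y yu.
    have : rho y < Num.min r0 d.
      apply: le_lt_trans yu _; have : 0 < Num.min r0 d by rewrite lt_min r00 d0.
      by lra.
    rewrite lt_min => /andP[/rho_lt Wy]; rewrite rhoW// => yd.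
    have [<- _ _] := WP y Wy.
    by apply: dV; rewrite -ball_normE /= distrC.
move=> u u0 ur0.
pose sc y := ring_stretch u `|c y - c x|.
pose w y := c x + sc y *: (c y - c x).
have wE y : `|w y - c x| = sc y * `|c y - c x|.
  rewrite /w addrC addKr normrZ ger0_norm//.
  by have /andP[] := ring_stretch_bounds `|c y - c x| u0.
have w_le y : `|w y - c x| <= `|c y - c x|.
  rewrite wE ler_piMl//.
  by have /andP[] := ring_stretch_bounds `|c y - c x| u0.
pose h y := if pselect (W y) then p (w y) else y.
have hW y : W y -> h y = p (w y) by rewrite /h; case: pselect.
have wr0 y : W y -> `|w y - c x| < r0.
  by move=> Wy; rewrite (le_lt_trans (w_le y))// -rhoW//; apply/rho_lt.
have h_out y : u <= rho y -> h y = y.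
  rewrite /h; case: pselect => // Wy; rewrite rhoW// => uy.
  rewrite /w /sc ring_stretch_out// scale1r addrC subrK.
  by have [] := WP y Wy.
exists h; split => //.
- move=> y; have [Wy|nWy] := pselect (W y).
    rewrite /continuous_at hW//.
    have cpw : {for y, continuous (p \o w)}.
      have [_ _ cy] := WP y Wy.
      apply: continuous_comp; last by have [] := pP _ (wr0 y Wy).
      have cyx : {for y, continuous (fun z => c z - c x)}.
        by apply: continuousB; [exact: cy|exact: cvg_cst].
      apply: continuousD; first exact: cvg_cst.
      apply: continuousZ => //.
      apply: (@continuous_comp _ _ _ (fun z => `|c z - c x|) (ring_stretch u)).
        by apply: continuous_comp => //; exact: norm_continuous.
      exact: ring_stretch_continuous.
    apply: cvg_trans cpw; apply: near_eq_cvg.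
    have : nbhs y W by exact: open_nbhs_nbhs.
    by apply: filterS => z Wz; rewrite hW.
  have uy : u < rho y by rewrite rhoN.
  rewrite /continuous_at (h_out _ (ltW uy)).
  apply: cvg_trans (@cvg_id _ (nbhs y)); apply: near_eq_cvg.
  have := crho y; move=> /cvgr_gt/(_ _ uy).
  by apply: filterS => z /ltW/h_out.
- move=> y yu; have Wy : W y by apply/rho_lt; lra.
  move: yu; rewrite rhoW// hW// => yu.
  by rewrite /w /sc ring_stretch_in// scale0r addr0.
- move=> y yu; have Wy : W y by apply/rho_lt; lra.
  rewrite hW// rho_p; last exact: wr0.
  by rewrite (le_trans (w_le y))// -rhoW.
- move=> z; have [uz|zu] := leP u (rho z).
    by exists z; [lra|exact: h_out].
  have Wz : W z by apply/rho_lt; lra.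
  have [pcz _ _] := WP z Wz.
  suff [v vu sv] : exists2 v : 'rV[R]_n, u / 2 <= `|v| <= u &
      ring_stretch u `|v| *: v = c z - c x.
    have /andP[v1 v2] := vu.
    have vr0 : `|(c x + v) - c x| < r0 by rewrite addrC addKr; lra.
    have [Wp cp _] := pP _ vr0.
    exists (p (c x + v)); first by rewrite rho_p// addrC addKr.
    rewrite hW// /w /sc cp [c x + v - c x]addrC addKr sv.
    by rewrite addrC subrK.
  (* The centre is the image of a vector of norm [u / 2], which exists in positive dimension. *)
  have [cz0|cz0] := eqVneq (c z - c x) 0.
    pose v1 : 'rV[R]_n := const_mx 1.
    have v10 : 0 < `|v1|.
      rewrite normr_gt0; apply/eqP => /rowP/(_ (Ordinal n0)).
      by rewrite !mxE => /eqP; rewrite oner_eq0.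
    exists ((u / 2 / `|v1|) *: v1).
      rewrite normrZ ger0_norm; last by rewrite !divr_ge0// ltW.
      by rewrite divfK ?gt_eqF//; lra.
    rewrite ring_stretch_in ?scale0r ?cz0//.
    rewrite normrZ ger0_norm; last by rewrite !divr_ge0// ltW.
    by rewrite divfK ?gt_eqF.
  pose t := `|c z - c x|.
  have t0 : 0 < t by rewrite normr_gt0.
  have tu : t < u by rewrite /t -rhoW.
  (* The norm [(t + u) / 2] solves [2 * s - u = t]. *)
  have nv : `|((t + u) / 2 / t) *: (c z - c x)| = (t + u) / 2.
    rewrite normrZ ger0_norm; last by rewrite !divr_ge0 ?addr_ge0// ltW.
    by rewrite divfK ?gt_eqF.
  exists (((t + u) / 2 / t) *: (c z - c x)); rewrite nv.
    by apply/andP; split; lra.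
  rewrite scalerA mulrA ring_stretch_mid//; [|lra|lra].
  have -> : 2 * ((t + u) / 2) - u = t by lra.
  by rewrite divff ?gt_eqF// scale1r.
Qed.

End surgery.

Lemma C0dist_le (R : realType) (M : pmetricType R) (f g : M -> M) (e : R) :
  (forall y, mdist (f y) (g y) <= e) -> C0dist f g <= e.
Proof.
move=> fg; apply: ge_sup; first by exists (mdist (f point) (g point)), point.
by move=> _ [y _ <-].
Qed.

Section splice.
Context {R : realType} {n : nat} {M : pmetricType R}.
Variable A : smoothAtlas n M.

(** The new map follows [G] on the inner half ball and [f \o h] elsewhere; both equal [f x] on the
    sphere between, as [chi (u / 2) = 0]. In the ball both maps stay within [e] of [f x], hence the
    bound [2 * e]. The function [rho] comes first because [u], [chi] and [G] will depend on it. *)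
Lemma exists_splice (f : M -> M) (x : M) (e : R) : compact [set: M] ->
    (0 < n)%N -> End f -> 0 < e ->
  exists (rho : M -> R), exists2 r0, 0 < r0 &
  [/\ continuous rho, rho x = 0, forall y, 0 <= rho y, forall y, rho y = 0 -> y = x &
    forall V, nbhs x V -> exists2 u, 0 < u & forall y, rho y <= u -> V y] /\
  forall (u : R) (chi : R -> R) (G : R -> M), 0 < u -> u < r0 ->
    continuous chi -> chi (u / 2) = 0 ->
    continuous G -> G 0 = f x -> (forall l, mdist (f x) (G l) < e) ->
    exists g : M -> M, [/\ End g, C0dist f g <= 2 * e,
      forall y, u <= rho y -> g y = f y,
      forall y, rho y <= u / 2 -> g y = G (chi (rho y)) &
      forall y, u / 2 <= rho y -> rho y <= u ->
        exists2 y', rho y' <= u & g y = f y'].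
Proof.
move=> cM n0 [cf fsurj] e0.
have [rho [r0 r00 [[crho rhox rho_ge0 rho_eq0 rho_nbhs] crush]]] :=
  exists_radial_crush A x cM n0.
have [r1 r10 r1P] := rho_nbhs _ (near_mdist_lt (cf x) e0).
exists rho, (Num.min r0 r1); first by rewrite lt_min r00 r10.
split => // u chi G u0 ur cchi chiu cG G0 Ge.
have [ur0 ur1] : u < r0 /\ u < r1 by apply/andP; rewrite -lt_min.
have [h [ch h_out h_in h_le h_surj]] := crush u u0 ur0.
pose g y := if rho y <= u / 2 then G (chi (rho y)) else f (h y).
have g_in y : rho y <= u / 2 -> g y = G (chi (rho y)) by rewrite /g => ->.
have g_out y : u / 2 <= rho y -> g y = f (h y).
  rewrite /g => uy; case: ifPn => // yu.
  have -> : rho y = u / 2 by apply/eqP; rewrite eq_le yu uy.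
  by rewrite chiu G0 h_in.
have cG' : continuous (fun y => G (chi (rho y))).
  move=> y; apply: continuous_comp; last exact: cG.
  by apply: continuous_comp; [exact: crho|exact: cchi].
have cfh : continuous (f \o h).
  by move=> y; apply: continuous_comp; [exact: ch|exact: cf].
exists g; split.
- split.
    move=> y V Vgy /=.
    have near1 : rho y <= u / 2 -> \forall z \near y, V (G (chi (rho z))).
      by move=> yu; apply: cG'; rewrite -g_in.
    have near2 : u / 2 <= rho y -> \forall z \near y, V (f (h z)).
      by move=> uy; apply: cfh; rewrite /= -g_out.
    have [yu|uy|yu] := ltgtP (rho y) (u / 2).
    + have := crho y; move=> /cvgr_lt/(_ _ yu).
      apply: filterS2 (near1 (ltW yu)) => z Vz /ltW zu.
      by rewrite /= g_in.
    + have := crho y; move=> /cvgr_gt/(_ _ uy).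
      apply: filterS2 (near2 (ltW uy)) => z Vz /ltW uz.
      by rewrite /= g_out.
    + have := near1; have := near2; rewrite yu lexx => /(_ isT) V2 /(_ isT).
      by apply: filterS2 V2 => z; rewrite /g /=; case: ifP.
  move=> z _; have [y _ <-] := fsurj z I.
  have [y' uy' hy'] := h_surj y.
  by exists y' => //; rewrite g_out ?hy'.
- apply: C0dist_le => y.
  have [uy|yu] := leP u (rho y).
    by rewrite g_out ?h_out ?mdistxx; lra.
  have fy : mdist (f x) (f y) < e by apply: r1P; lra.
  have gy : mdist (f x) (g y) < e.
    have [yu2|uy2] := leP (rho y) (u / 2); first by rewrite g_in.
    rewrite g_out ?(ltW uy2)//; apply: r1P.
    by have := h_le y (ltW yu); lra.
  have := metric_triangle (f y) (f x) (g y).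
  by rewrite (metric_sym (f y) (f x)); lra.
- by move=> y uy; rewrite g_out ?h_out//; lra.
- exact: g_in.
- by move=> y uy yu; exists (h y); [exact: h_le|exact: g_out].
Qed.

(** With charts valued in a one-point space every point is isolated, uniformly by compactness, so a
    close return is an exact one. *)
Lemma discrete_dim0 : compact [set: M] -> n = 0%N ->
  exists2 d : R, 0 < d & forall p q : M, mdist p q < d -> p = q.
Proof.
move=> cM n0.
have [] := @compact_near_pos R M setT (fun d p => forall q, mdist p q < d -> p = q) cM.
- by move=> r r' z rr' H q zq; apply: H; exact: lt_le_trans rr'.
- move=> x _.
  have [c [p [r0 r00 [W [oW Wx WP _]]]]] := exists_local_chart A x.
  have Wsub y : W y -> y = x.
    move=> Wy; have [<- _ _] := WP y Wy; have [<- _ _] := WP x Wx.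
    congr p; apply/rowP => j; have := ltn_ord j; rewrite [in X in (_ < X)%N]n0.
    by [].
  have : nbhs x W by exact: open_nbhs_nbhs.
  move=> /(nbhs_ballP _ _).1 [r /= r0' rW].
  exists r => //; have : nbhs x W by exact: open_nbhs_nbhs.
  apply: filterS => y /Wsub -> q xq.
  by symmetry; apply/Wsub/rW; rewrite ballEmdist.
by move=> r r0 rP; exists r => // p q; exact: rP.
Qed.

End splice.

(** * Perturbations with a periodic maximizing measure *)

Definition has_periodic_maximizer (R : realType) (M : pmetricType R)
    (phi : M -> R) (g : M -> M) :=
  exists2 mu : probability (borel M) R, maximizing phi g mu &
    exists2 O : set M, periodic_orbit g O & supported_on mu O.

Section perturbation.
Context {R : realType} {n : nat} {M : pmetricType R}.
Variable A : smoothAtlas n M.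
Variables (phi : M -> R) (f : M -> M).
Hypotheses (cM : compact [set: M]) (n0 : (0 < n)%N) (cphi : continuous phi).
Hypothesis Ef : End f.

Let cf : continuous f. Proof. by have [] := Ef. Qed.

(** An excursion of the new map starts within [e'] of [f x], and one more step of [f] after its end
    leads within [e'] of [f x] again. It is a [d1]-return of [f], so the potential 0 suffices. *)
Lemma perturb_no_strict_return (e d1 : R) : 0 < e -> 0 < d1 ->
    (forall t k, mdist (iter k.+1 f t) t < d1 ->
      birkhoff f phi k.+1 t <= k.+1%:R * max_rate f phi) ->
  exists g, [/\ End g, C0dist f g < e & has_periodic_maximizer phi g].
Proof.
move=> e0 d10 no_strict.
have [L L0 phiL] := continuous_bounded cM cphi.
(* The surgery moves points by at most [2 * e'], and two distances below [e'] add up to less than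
   [d1]. *)
pose e' := Num.min (e / 4) (d1 / 2).
have e'0 : 0 < e' by rewrite lt_min !divr_gt0.
have [e'e e'd] : e' <= e / 4 /\ e' <= d1 / 2 by apply/andP; rewrite -le_min.
have [d2 d20 paths] := small_paths A cM e'0.
have [v [l' [l'0 vl Sl]]] := exists_closing_orbit cM cf cphi d20.
case: l' l'0 vl Sl => // l _ vl Sl.
set x := iter l f v.
(* The first hit of [x] replaces [l], so that the orbit avoids a small ball around [x] before it. *)
have hit : exists k, `[< iter k f v = x >] by exists l; apply/asboolP.
pose k := ex_minn hit.
have [kx kmin] : iter k f v = x /\ forall j, iter j f v = x -> (k <= j)%N.
  rewrite /k; case: ex_minnP => j /asboolP jx jmin; split => // i ix.
  by apply: jmin; apply/asboolP.
have kl : (k <= l)%N by exact: kmin.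
(* The part cut off is a cycle through [f x], of mean at most the maximal rate. *)
have Sk : k.+1%:R * max_rate f phi <= birkhoff f phi k.+1 v.
  pose p := (l - k)%N; have lE : l.+1 = (k.+1 + p)%N by rewrite /p; lia.
  have px : iter p f (iter k.+1 f v) = iter k.+1 f v.
    by rewrite -iterD addnC -lE /= kx.
  move: Sl; rewrite lE birkhoffD natrD mulrDl.
  by have := periodic_le_max_rate phiL px; lra.
have [G [cG G0 G1 Ge]] := paths _ _ vl.
have [rho [r0 r00 [[crho rhox rho_ge0 rho_eq0 rho_nbhs] splice]]] :=
  exists_splice A x cM n0 Ef e'0.
have [r1 r10 r1P] := rho_nbhs _ (near_mdist_lt (cf (x := x)) e'0).
have [r2 r20 r2P] : exists2 r, 0 < r & forall j, (j <= k)%N -> (j < k)%N ->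
    r <= rho (iter j f v).
  apply: finite_near_pos => [r r' j rr' H jk|j _].
    exact: le_trans rr' (H jk).
  have [jx|jx] := eqVneq (iter j f v) x.
    by exists 1 => // jk; have := kmin j jx; rewrite leqNgt jk.
  exists (rho (iter j f v)) => //; rewrite lt_neqAle rho_ge0 andbT eq_sym.
  by apply: contraNneq jx => /rho_eq0 ->.
pose u := Num.min (r0 / 2) (Num.min r1 r2).
have u0 : 0 < u by rewrite !lt_min divr_gt0// r10 r20.
have [ur0 ur1 ur2] : [/\ u < r0, u <= r1 & u <= r2].
  have : u <= Num.min (r0 / 2) (Num.min r1 r2) by [].
  rewrite !le_min => /and3P[? ? ?].
  by split => //; lra.
pose chi (a : R) := Num.max 0 (1 - a / (u / 2)).
have cchi : continuous chi.
  move=> a; change {for a, continuous (fun a : R => Num.max 0 (1 - a / (u / 2)))}.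
  apply: continuous_max; first exact: cvg_cst.
  apply: continuousB; first exact: cvg_cst.
  by apply: continuousM; [exact: cvg_id|exact: cvg_cst].
have chiu : chi (u / 2) = 0.
  by rewrite /chi divff ?subrr ?maxxx// gt_eqF// divr_gt0.
have chi0 : chi 0 = 1 by rewrite /chi mul0r subr0 max_r.
have [g [Eg fg_dist g_out g_in g_mid]] := splice u chi G u0 ur0 cchi chiu cG G0 Ge.
exists g; split => //; first by lra.
pose U : set M := [set y | rho y < u].
have fgU y : ~ U y -> g y = f y by move=> /negP; rewrite -leNgt; exact: g_out.
have nUv i : (i < k)%N -> ~ U (iter i f v).
  by move=> ik; apply/negP; rewrite -leNgt (le_trans ur2)// r2P// ltnW.
have gv : g (iter k f v) = v.
  by rewrite kx g_in rhox ?chi0// divr_ge0 ?(ltW u0).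
have gper := iter_outside_periodic fgU nUv gv.
apply: (exists_maximizing_periodic Eg.1 cphi phiL (m := max_rate f phi) _ gper) => //.
  by rewrite (birkhoff_outside phi fgU nUv).
move=> m' mm'.
apply: (upper_rate_return fgU (upper_rate_gt phiL mm') (lexx 0)
  (psi := fun=> 0)) => [y _|y j Uy Uj]; first by rewrite lexx.
rewrite addr0 subr0.
apply: (@le_trans _ _ (j.+1%:R * max_rate f phi)); last first.
  by rewrite ler_wpM2l// ltW.
apply: no_strict.
have fy z : rho z <= u -> mdist (f x) (f z) < e'.
  by move=> zu; apply: r1P; exact: le_trans ur1.
have gy : mdist (f x) (g y) < e'.
  have [yu|uy] := leP (rho y) (u / 2); first by rewrite g_in// Ge.
  by have [y' y'u ->] := g_mid _ (ltW uy) (ltW Uy); exact: fy.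
have := metric_triangle (iter j.+1 f (g y)) (f x) (g y).
have := fy _ (ltW Uj); rewrite [mdist (iter _ _ _) (f x)]metric_sym /=.
by lra.
Qed.

End perturbation.

(** * The first point of a path with a good hitting mean *)

Section extremal_cycle.
Context {R : realType} {M : pmetricType R}.
Variables (phi : M -> R) (f : M -> M) (x : M).
Hypotheses (cM : compact [set: M]) (cphi : continuous phi) (cf : continuous f).

(* Among the points of the path whose orbit hits [x] with a mean beating the
   maximal rate, take the first one: hitting times are bounded there, because
   long orbit segments have a smaller mean. *)
Lemma exists_extremal_cycle (G0 : R -> M) (k0 : nat) :
    continuous G0 -> G0 0 = f x -> iter k0 f (G0 1) = x ->
    k0.+1%:R * max_rate f phi < birkhoff f phi k0.+1 (G0 1) ->
  exists (G : R -> M) (m : R) (N k : nat),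
    [/\ continuous G, G 0 = f x & forall l, exists l', G l = G0 l'] /\
    [/\ max_rate f phi < m, (k <= N)%N, iter k f (G 1) = x,
        birkhoff f phi k.+1 (G 1) = k.+1%:R * m &
        forall y j, (N < j)%N -> birkhoff f phi j.+1 y <= j.+1%:R * m - 1] /\
    forall j l, (j <= N)%N -> 0 <= l <= 1 -> iter j f (G l) = x ->
      birkhoff f phi j.+1 (G l) <= j.+1%:R * m /\
      (l < 1 -> birkhoff f phi j.+1 (G l) < j.+1%:R * m).
Proof.
move=> cG0 G00 k0x k0S; set b := max_rate f phi in k0S *.
have [L L0 phiL] := continuous_bounded cM cphi.
pose m2 := birkhoff f phi k0.+1 (G0 1) / k0.+1%:R.
have bm2 : b < m2 by rewrite ltr_pdivlMr ?ltr0n// mulrC.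
pose m1 := (b + m2) / 2.
have bm1 : b < m1 by rewrite /m1; lra.
have m12 : 0 < m2 - m1 by rewrite /m1; lra.
have [C fC] := upper_rate_gt phiL bm1.
(* Beyond [N] the gap between [m1] and [m2] absorbs [C] and leaves a deficit of 1. *)
pose N := Num.truncn ((C + 1) / (m2 - m1)).
have long y j : (N < j)%N -> birkhoff f phi j.+1 y <= j.+1%:R * m2 - 1.
  move=> Nj; apply: le_trans (fC j.+1 y) _.
  have : (C + 1) / (m2 - m1) < j.+1%:R.
    by rewrite (lt_le_trans (truncnS_gt _))// ler_nat ltnW.
  by rewrite ltr_pdivrMr//; lra.
have k0N : (k0 <= N)%N.
  rewrite leqNgt; apply/negP => /(long (G0 1)).
  by rewrite /m2 mulrC divfK ?pnatr_eq0//; lra.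
pose good l j := iter j f (G0 l) = x /\
  j.+1%:R * m2 <= birkhoff f phi j.+1 (G0 l).
pose Good := [set l | 0 <= l <= 1 /\ exists2 j, (j <= N)%N & good l j].
have Good1 : Good 1.
  split; first by rewrite ler01 lexx.
  by exists k0 => //; split => //; rewrite /m2 mulrC divfK ?pnatr_eq0.
have infGood : has_inf Good.
  by split; [exists 1|exists 0 => l [/andP[]]].
pose l0 := inf Good.
have l0_le l : Good l -> l0 <= l by apply: ge_inf; exact: infGood.2.
have l00 : 0 <= l0.
  by apply: lb_le_inf; [exists 1|move=> l [/andP[]]].
have l01 : l0 <= 1 by exact: l0_le.
(* The infimum is attained: for each of the finitely many times [j], failing to be good is an open
   condition. *)
have Good_l0 : Good l0.
  apply: contrapT => nGood.
  have [r r0 rP] : exists2 r, 0 < r & forall j, (j <= N)%N -> forall l,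
      `|l0 - l| < r -> ~ good l j.
    apply: finite_near_pos => [r r' j rr' H l lr|j jN].
      by apply: H; exact: lt_le_trans rr'.
    suff : \forall l \near l0, ~ good l j.
      move=> /(nbhs_ballP _ _).1 [r /= r0 rP]; exists r => //.
    have cGj : {for l0, continuous (fun l => iter j f (G0 l))}.
      by apply: continuous_comp; [exact: cG0|exact: continuous_iter].
    have [jx|jx] := eqVneq (iter j f (G0 l0)) x.
      have : ~ (j.+1%:R * m2 <= birkhoff f phi j.+1 (G0 l0)).
        by move=> Sj; apply: nGood; split; [rewrite l00 l01|exists j].
      move=> /negP; rewrite -ltNge => Sj.
      have cS : {for l0, continuous (fun l => birkhoff f phi j.+1 (G0 l))}.
        apply: (@continuous_comp _ _ _ G0 (birkhoff f phi j.+1)).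
          exact: cG0.
        exact: continuous_birkhoff.
      move: cS => /cvgr_lt/(_ _ Sj); apply: filterS => l Sl [_].
      by rewrite leNgt Sl.
    have cd : {for l0, continuous (fun l => mdist (iter j f (G0 l)) x : R)}.
      by apply: mdist_continuous; [exact: cGj|exact: cvg_cst].
    have d0 : 0 < mdist (iter j f (G0 l0)) x by rewrite mdist_gt0.
    move: cd => /cvgr_gt/(_ _ d0); apply: filterS => l dl [lx _].
    by move: dl; rewrite lx mdistxx ltxx.
  have [l Gl ll0] := inf_adherent r0 infGood.
  have [_ [j jN gl]] := Gl; apply: (rP j jN l _ gl).
  rewrite distrC ger0_norm ?subr_ge0; last exact: l0_le.
  by rewrite ltrBlDl.
have [_ [j0 j0N [j0x j0S]]] := Good_l0.
(* At parameter 0 a hit would close a cycle through [f x], whose mean cannot exceed the maximal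
   rate. *)
have l0_gt0 : 0 < l0.
  rewrite lt_neqAle l00 andbT; apply/eqP => l0E.
  move: j0x j0S; rewrite -l0E G00 => j0x.
  have per : iter j0.+1 f (f x) = f x by rewrite iterS j0x.
  have := periodic_le_max_rate phiL per; rewrite -/b => S1 S2.
  have : j0.+1%:R * b < j0.+1%:R * m2 by rewrite ltr_pM2l// ltr0n.
  by lra.
(* The orbit of the first good point may hit [x] several times; the hit of largest mean defines [m],
   which is at least [m2]. *)
pose P (i : 'I_N.+1) := `[< iter i f (G0 l0) = x >].
pose F (i : 'I_N.+1) := birkhoff f phi i.+1 (G0 l0) / i.+1%:R.
have j0N1 : (j0 < N.+1)%N by [].
have Pj0 : P (Ordinal j0N1) by apply/asboolP.
pose i := [arg max_(i > Ordinal j0N1 | P i) F i]%O.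
have [Pi Fi] : P i /\ forall j, P j -> F j <= F i.
  by rewrite /i; case: arg_maxP => // i' Pi' Fi'.
pose m := F i.
have m2m : m2 <= m.
  apply: le_trans (Fi _ Pj0); rewrite /F/= ler_pdivlMr ?ltr0n// mulrC.
  exact: j0S.
pose t (l : R) := Num.max 0 (Num.min 1 l).
have t01 (l : R) : 0 <= l <= 1 -> t l = l.
  by move=> /andP[l1 l2]; rewrite /t min_r// max_r.
pose G l := G0 (l0 * t l).
have G1 : G 1 = G0 l0 by rewrite /G t01 ?ler01 ?lexx// mulr1.
exists G, m, N, (i : nat); split; last split.
- split; last by move=> l; exists (l0 * t l).
    move=> l; apply: (@continuous_comp _ _ _ (fun l => l0 * t l) G0); last exact: cG0.
    apply: continuousM; first exact: cvg_cst.
    apply: continuous_max; first exact: cvg_cst.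
    by apply: continuous_min; [exact: cvg_cst|exact: cvg_id].
  by rewrite /G t01 ?lexx ?ler01// mulr0.
- split.
  + exact: lt_le_trans m2m.
  + by rewrite -ltnS.
  + by rewrite G1; apply/asboolP.
  + by rewrite G1 /m /F mulrC divfK// pnatr_eq0.
  + move=> y j Nj; apply: le_trans (long y j Nj) _.
    by rewrite lerD2r ler_wpM2l.
- move=> j l jN l_01 jx.
  have [l1|l1] := ltP l 1; last first.
    have lE : l = 1 by apply/eqP; rewrite eq_le l1 andbT; case/andP: l_01.
    rewrite lE; split => //; move: jx; rewrite lE G1 => jx.
    have jN1 : (j < N.+1)%N by [].
    have /Fi : P (Ordinal jN1) by apply/asboolP.
    by rewrite /F/= ler_pdivrMr ?ltr0n// mulrC.
  suff S : birkhoff f phi j.+1 (G l) < j.+1%:R * m by split => //; exact: ltW.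
  apply: (@lt_le_trans _ _ (j.+1%:R * m2)); last by rewrite ler_wpM2l.
  rewrite ltNge; apply/negP => Sj.
  have /andP[l_0 l_1] := l_01.
  have : l0 <= l0 * l.
    apply: l0_le; split; last by exists j => //; move: jx Sj; rewrite /G t01.
    by rewrite mulr_ge0//= (le_trans _ l01)// ler_piMr.
  by rewrite leNgt -subr_lt0 -[X in _ - X]mulr1 -mulrBr pmulr_rlt0// subr_lt0 l1.
Qed.

End extremal_cycle.

(** * Perturbation at a strict return *)

Section strict_return.
Context {R : realType} {n : nat} {M : pmetricType R}.
Variable A : smoothAtlas n M.
Variables (phi : M -> R) (f : M -> M).
Hypotheses (cM : compact [set: M]) (n0 : (0 < n)%N) (cphi : continuous phi).
Hypothesis Ef : End f.

Let cf : continuous f. Proof. by have [] := Ef. Qed.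

(** The target mean [m] exceeds the maximal rate of [f], hence is an upper rate of [f]. It remains
    to bound the excursions of the new map by increments of [psi (rho y)]. *)
Lemma perturb_strict_return (e : R) (G0 : R -> M) (x : M) (k0 : nat) :
    0 < e -> continuous G0 -> G0 0 = f x -> iter k0 f (G0 1) = x ->
    (forall l, mdist (f x) (G0 l) < e) ->
    k0.+1%:R * max_rate f phi < birkhoff f phi k0.+1 (G0 1) ->
  exists g, [/\ End g, C0dist f g <= 2 * e & has_periodic_maximizer phi g].
Proof.
move=> e0 cG0 G00 k0x G0e k0S.
have [L L0 phiL] := continuous_bounded cM cphi.
have [G [m [N [k [[cG Gfx GG0] [[bm kN kx kS long] hits]]]]]] :=
  exists_extremal_cycle cM cphi cf cG0 G00 k0x k0S.
have Ge l : mdist (f x) (G l) < e by have [l' ->] := GG0 l.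
have h01 : 0 <= (0 : R) <= 1 by rewrite lexx ler01.
(* An earlier hit would split the cycle into a hit from [G 1], of mean at most [m], and one from
   [G 0 = f x], of mean strictly below [m]. *)
have first_hit j : (j < k)%N -> iter j f (G 1) <> x.
  move=> jk jx.
  have jN : (j <= N)%N by exact: leq_trans (ltnW jk) kN.
  have [Sj _] := hits j 1 jN (introT andP (conj ler01 (lexx 1))) jx.
  pose p := (k - j).-1.
  have kE : k.+1 = (j.+1 + p.+1)%N by rewrite /p; lia.
  have px : iter p f (f x) = x.
    have kjp : k = (p.+1 + j)%N by rewrite /p; lia.
    by rewrite -iterSr -[RHS]kx kjp iterD jx.
  have pN : (p <= N)%N by rewrite /p; lia.
  have := hits p 0 pN h01.
  rewrite Gfx => /(_ px)[_ /(_ ltr01) Sp].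
  by move: kS; rewrite kE birkhoffD iterS jx natrD mulrDl; lra.
have [rho [r0 r00 [[crho rhox rho_ge0 rho_eq0 rho_nbhs] splice]]] :=
  exists_splice A x cM n0 Ef e0.
pose a j l := rho (iter j f (G l)).
pose s j l := birkhoff f phi j.+1 (G l) - j.+1%:R * m.
have ca j : continuous (a j).
  move=> l; apply: (@continuous_comp _ _ _ (fun l => iter j f (G l)) rho).
    by apply: continuous_comp; [exact: cG|exact: continuous_iter].
  exact: crho.
have cs j : continuous (s j).
  move=> l.
  change {for l, continuous (fun l => birkhoff f phi j.+1 (G l) - j.+1%:R * m)}.
  apply: continuousB; last exact: cvg_cst.
  apply: (@continuous_comp _ _ _ G (birkhoff f phi j.+1)); first exact: cG.
  exact: continuous_birkhoff.
have a_ge0 j l : 0 <= a j l by exact: rho_ge0.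
have hit_s j l : (j <= N)%N -> 0 <= l <= 1 -> a j l = 0 ->
    s j l <= 0 /\ (l < 1 -> s j l < 0).
  move=> jN l01 /rho_eq0 jx; have [S1 S2] := hits j l jN l01 jx.
  by rewrite /s subr_le0; split => // l1; rewrite subr_lt0 S2.
(* [w] controls the excess [s] of a return in terms of its distance [a] to [x]. *)
have [w [cw w0 w_ge0 w_mono w_s]] : exists w : R -> R, [/\ continuous w, w 0 = 0,
    forall y, 0 <= w y, forall y z, y <= z -> w y <= w z &
    forall j l, (j <= N)%N -> 0 <= l <= 1 -> s j l <= w (a j l)].
  pose Z := [set z : nat * R | (z.1 <= N)%N /\ 0 <= z.2 <= 1].
  have [] := @exists_vanishing_majorant R _ Z (fun z => s z.1 z.2)
    (fun z => a z.1 z.2) (N.+1%:R * (L + `|m|)).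
  - move=> [j l] [/= jN _]; rewrite /s.
    have := birkhoff_le f j.+1 (G l) phiL.
    have : - m <= `|m| by rewrite -normrN ler_norm.
    have : j.+1%:R * (L + `|m|) <= N.+1%:R * (L + `|m|).
      by rewrite ler_wpM2r ?ler_nat// addr_ge0// ltW.
    move=> H1 H2 H3; apply: le_trans H1.
    have : j.+1%:R * - m <= j.+1%:R * `|m| by rewrite ler_wpM2l.
    by rewrite mulrDr mulrN; lra.
  - move=> e1 e10.
    have [r r_gt0 rP] : exists2 r, 0 < r & forall j, (j <= N)%N ->
        forall l, `[0, 1]%classic l -> a j l <= r -> s j l <= e1.
      apply: finite_near_pos => [r r' j rr' H l l01 ar|j jN].
        exact: H l l01 (le_trans ar rr').
      apply: (compact_near_pos (segment_compact (a := 0) (b := 1))).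
        by move=> r r' l rr' H ar; apply: H; exact: le_trans rr'.
      move=> l /=; rewrite in_itv/= => l01.
      have [se|es] := ltP (s j l) e1.
        exists 1 => //; have := cs j l; move=> /cvgr_lt/(_ _ se).
        by apply: filterS => z /ltW.
      have al : 0 < a j l.
        rewrite lt_neqAle a_ge0 andbT eq_sym; apply/eqP => al0.
        by have [] := hit_s j l jN l01 al0; lra.
      have al2 : a j l / 2 < a j l by lra.
      exists (a j l / 2); first by lra.
      have := ca j l; move=> /cvgr_gt/(_ _ al2).
      by apply: filterS => z z1 z2; lra.
    exists r => // -[j l] [/= jN l01] ajl.
    by apply: (rP j jN l _ ajl); rewrite /= in_itv.
  move=> w [cw w0 w_ge0 w_mono wZ]; exists w; split => // j l jN l01.
  exact: (wZ (j, l)).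
(* The term [2 * w] dominates the sum of [s] and its absolute value, so that [psi (a j l) - s j l]
   is still at least [E j l]. *)
pose psi y := y + 2 * w y.
have psi_mono y z : y <= z -> psi y <= psi z.
  by move=> yz; have := w_mono _ _ yz; rewrite /psi; lra.
have psi00 : psi 0 = 0 by rewrite /psi w0; lra.
have psi0 e1 : 0 < e1 -> exists2 r, 0 < r & psi r <= e1.
  move=> e10; have e13 : w 0 < e1 / 3 by rewrite w0 divr_gt0.
  have := cw 0; move=> /cvgr_lt/(_ _ e13)/(nbhs_ballP _ _).1 [r /= r_gt0 rw].
  exists (Num.min (r / 2) (e1 / 3)); first by rewrite lt_min !divr_gt0.
  have : w (Num.min (r / 2) (e1 / 3)) < e1 / 3.
    apply: rw; rewrite /ball/= sub0r normrN ger0_norm.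
      by rewrite gt_min; apply/orP; left; lra.
    by rewrite le_min !divr_ge0// ltW.
  have : Num.min (r / 2) (e1 / 3) <= e1 / 3 by rewrite ge_min lexx orbT.
  by rewrite /psi; lra.
(* It vanishes only at a hit without excess, which for [l < 1] is excluded by the choice of the
   cycle. *)
pose E j l := a j l + `|s j l|.
have psi_E j l : (j <= N)%N -> 0 <= l <= 1 -> E j l <= psi (a j l) - s j l.
  move=> jN l01; have := w_s j l jN l01; have := w_ge0 (a j l).
  rewrite /E /psi; have [s0|s0] := leP 0 (s j l).
    by rewrite ger0_norm//; lra.
  by rewrite ltr0_norm//; lra.
have E_gt0 j l : (j <= N)%N -> 0 <= l -> l < 1 -> 0 < E j l.
  move=> jN l00 l1; have l01 : 0 <= l <= 1 by rewrite l00 ltW.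
  have [al0|al0] := eqVneq (a j l) 0.
    rewrite /E al0 add0r normr_gt0; apply/eqP => s0.
    by have [_ /(_ l1)] := hit_s j l jN l01 al0; rewrite s0 ltxx.
  by rewrite ltr_pwDl// lt_neqAle eq_sym al0 a_ge0.
have cE j : continuous (E j).
  move=> l; change {for l, continuous (fun l => a j l + `|s j l|)}.
  apply: continuousD; first exact: ca.
  apply: (@continuous_comp _ _ _ (s j) (fun t : R => `|t|)); first exact: cs.
  exact: norm_continuous.
(* Orbits of points near [x] that return near [x] without using the path lose a
   definite amount. *)
have [c c0 c_loss] : exists2 c, 0 < c & forall j, (j <= N)%N -> forall y,
    rho y <= c -> rho (iter j f (f y)) <= c ->
    birkhoff f phi j.+1 (f y) <= j.+1%:R * m - c.
  apply: finite_near_pos => [r r' j rr' H y yr jr|j jN].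
    apply: (@le_trans _ _ (j.+1%:R * m - r)); last by rewrite lerD2l lerN2.
    by apply: H; exact: le_trans rr'.
  have cjf : {for x, continuous (fun y => iter j f (f y))}.
    by apply: continuous_comp; [exact: cf|exact: continuous_iter].
  have [jx|jx] := eqVneq (a j 0) 0.
    have [_ /(_ ltr01) s0] := hit_s j 0 jN h01 jx.
    pose d := - s j 0 / 2.
    have d0 : 0 < d by rewrite /d; lra.
    have Sd : birkhoff f phi j.+1 (f x) < j.+1%:R * m - d.
      by rewrite /d /s Gfx in s0 *; lra.
    have cS : {for x, continuous (fun y => birkhoff f phi j.+1 (f y))}.
      apply: (@continuous_comp _ _ _ f (birkhoff f phi j.+1)); first exact: cf.
      exact: continuous_birkhoff.
    have [r r_gt0 rP] := rho_nbhs _ (cvgr_lt _ cS _ Sd).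
    exists (Num.min r d); first by rewrite lt_min r_gt0.
    move=> y; rewrite le_min => /andP[/rP/= Sy _] _.
    apply: (le_trans (ltW Sy)); rewrite lerD2l lerN2 ge_min lexx orbT//.
  have aj : 0 < rho (iter j f (f x)).
    by rewrite -Gfx lt_neqAle eq_sym jx rho_ge0.
  have aj2 : rho (iter j f (f x)) / 2 < rho (iter j f (f x)) by lra.
  have cr : {for x, continuous (fun y => rho (iter j f (f y)))}.
    apply: (@continuous_comp _ _ _ (fun y => iter j f (f y)) rho) => //.
    exact: crho.
  have [r r_gt0 rP] := rho_nbhs _ (cvgr_gt _ cr _ aj2).
  exists (Num.min r (rho (iter j f (f x)) / 2)).
    by rewrite lt_min r_gt0 divr_gt0.
  move=> y; rewrite !le_min => /andP[/rP/= ry _] /andP[_ yr].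
  by lra.
(* This radius keeps the new cycle out of the ball before time [k], and its bound on [E j 0] allows
   the profile to end at 0. *)
have [r1 r10 r1P] : exists2 r, 0 < r & forall j, (j <= N)%N ->
    ((j < k)%N -> r <= a j 1) /\ r <= E j 0.
  apply: finite_near_pos => [r r' j rr' [H1 H2]|j jN].
    by split => [jk|]; [exact: le_trans rr' (H1 jk)|exact: le_trans rr' H2].
  have Ej : 0 < E j 0 by apply: E_gt0.
  have [jk|kj] := ltnP j k; last by exists (E j 0).
  have aj : 0 < a j 1.
    rewrite lt_neqAle eq_sym a_ge0 andbT; apply/eqP => /rho_eq0.
    exact: first_hit.
  exists (Num.min (a j 1) (E j 0)); first by rewrite lt_min aj.
  by split => [_|]; rewrite ge_min lexx ?orbT.
(* Keeping [psi u] below [c] and 1 handles the excursions with a loss and the long ones; [r1] serves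
   the profile. *)
pose e1 := Num.min c (Num.min 1 r1).
have e10 : 0 < e1 by rewrite !lt_min c0 ltr01 r10.
have [r2 r20 r2P] := psi0 e1 e10.
pose u := Num.min (r0 / 2) (Num.min r2 e1).
have u0 : 0 < u by rewrite !lt_min divr_gt0// r20 c0 ltr01 r10.
have [ur0 uc ur1 psiu] : [/\ u < r0, u <= c, u <= r1 & psi u <= e1].
  have : u <= Num.min (r0 / 2) (Num.min r2 e1) by [].
  rewrite !le_min => /and5P[u1 u2 u3 _ u5]; split => //; first by lra.
  by have := le_trans (psi_mono _ _ u2) r2P; rewrite !le_min.
have [psic psi1 psir1] : [/\ psi u <= c, psi u <= 1 & psi u <= r1].
  by move: psiu; rewrite !le_min => /and3P[].
(* Choosing [chi] as below makes the new map so expanding at [x] that a return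
   either loses or ends much farther from [x] than it started. *)
have u20 : 0 < u / 2 by rewrite divr_gt0.
have psi_u2 j : (j <= N)%N -> psi (u / 2) <= E j 0.
  move=> jN; apply: le_trans (r1P j jN).2; apply: le_trans psir1.
  by apply: psi_mono; lra.
have [chi [cchi chi0 chiu chi01 chiP]] :=
  exists_profile u20 (fun j _ => cE j) E_gt0 psi0 psi_mono psi_u2.
have [g [Eg fg_dist g_out g_in g_mid]] := splice u chi G u0 ur0 cchi chiu cG Gfx Ge.
exists g; split => //.
pose U : set M := [set y | rho y < u].
have fgU y : ~ U y -> g y = f y by move=> /negP; rewrite -leNgt; exact: g_out.
have nUv i : (i < k)%N -> ~ U (iter i f (G 1)).
  move=> ik; apply/negP; rewrite -leNgt (le_trans ur1)//.
  by apply: (r1P i _).1 => //; exact: leq_trans (ltnW ik) kN.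
have gv : g (iter k f (G 1)) = G 1 by rewrite kx g_in rhox ?chi0// ltW.
have gper := iter_outside_periodic fgU nUv gv.
apply: (exists_maximizing_periodic Eg.1 cphi phiL (m := m) _ gper) => //.
  by rewrite (birkhoff_outside phi fgU nUv) kS.
move=> m' /ltW mm'; apply: upper_rate_le mm' _.
have psi_rho y : U y -> 0 <= psi (rho y) <= psi u.
  by move=> Uy; rewrite -[X in X <= _ <= _]psi00 !psi_mono// ltW.
apply: (upper_rate_return fgU (upper_rate_gt phiL bm) _ psi_rho).
  by rewrite -psi00; apply: psi_mono; exact: ltW.
move=> y j Uy Uj.
have /andP[_ psiy] := psi_rho y Uy.
have /andP[psij _] := psi_rho _ Uj.
have [jN|Nj] := leqP j N; last by have := long (g y) j Nj; lra.
(* From the ring, [g y] is also the [f]-image of a point of the ball, so the loss [c] applies; from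
   the inner ball, [g y] lies on the path. *)
have [yu|uy] := leP (rho y) (u / 2); last first.
  have [y' y'u gy] := g_mid _ (ltW uy) (ltW Uy).
  have := c_loss j jN y' (le_trans y'u uc); rewrite -gy.
  by move=> /(_ (le_trans (ltW Uj) uc)); lra.
have l01 := chi01 (rho y).
have := psi_E j (chi (rho y)) jN l01.
rewrite /a /s -g_in//.
have [rho0|rho_neq0] := eqVneq (rho y) 0.
  have : 0 <= E j (chi (rho y)) by rewrite addr_ge0.
  by rewrite rho0 psi00; lra.
have rho_gt0 : 0 < rho y by rewrite lt_neqAle eq_sym rho_neq0 rho_ge0.
by have [_ /(_ j jN)] := chiP _ rho_gt0 yu; lra.
Qed.

End strict_return.

(** The two perturbations are the two sides of a dichotomy on strict [d1]-returns. In dimension 0 no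
    perturbation is made: [f] itself has an optimal cycle. *)
Lemma dense_periodic_maximizer (R : realType) (n : nat) (M : pmetricType R)
    (A : smoothAtlas n M) (phi : M -> R) : compact [set: M] -> continuous phi ->
  forall f, End f -> forall e : R, 0 < e ->
  exists g, [/\ End g, C0dist f g < e & has_periodic_maximizer phi g].
Proof.
move=> cM cphi f Ef e e0; have [cf _] := Ef.
have [L L0 phiL] := continuous_bounded cM cphi.
have [n0|n0] := posnP n.
  have [d d0 dP] := discrete_dim0 A cM n0.
  have [v [l [l0 /dP vl Sl]]] := exists_closing_orbit cM cf cphi d0.
  exists f; split => //.
    by apply: le_lt_trans e0; apply: C0dist_le => y; rewrite mdistxx.
  apply: (exists_maximizing_periodic cf cphi phiL l0 vl Sl) => m'.
  exact: upper_rate_gt.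
have e40 : 0 < e / 4 by rewrite divr_gt0.
have [d1 d10 paths] := small_paths A cM e40.
have [[t [k [tk Sk]]]|nstrict] := pselect (exists t k,
    mdist (iter k.+1 f t) t < d1 /\
    k.+1%:R * max_rate f phi < birkhoff f phi k.+1 t).
  have [G [cG G0 G1 Ge]] := paths _ _ tk.
  rewrite -G1 in Sk.
  have kx : iter k f (G 1) = iter k f t by rewrite G1.
  have [g [Eg fg mg]] := perturb_strict_return A cM n0 cphi Ef e40 cG G0 kx Ge Sk.
  by exists g; split => //; lra.
apply: (perturb_no_strict_return A cM n0 cphi Ef e0 d10) => t k tk.
by rewrite leNgt; apply/negP => Sk; apply: nstrict; exists t, k.
Qed.

Unset Implicit Arguments.

Theorem theorem1 (R : realType) (n : nat) (M : pmetricType R)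
    (A : smoothAtlas n M) (g : riemannianMetric A)
    (M_compact : compact [set: M]) (M_dist : riemannian_distance g)
    (phi0 : M -> R) (phi0_continuous : continuous phi0) :
  exists2 D : set (M -> M), dense_in_End D &
    forall f, D f -> exists2 mu : probability (borel M) R,
      maximizing phi0 f mu &
      exists2 O : set M, periodic_orbit f O & supported_on mu O.
Proof.
exists [set f | End f /\ has_periodic_maximizer phi0 f]; last by move=> f [].
split=> [f []//|f Ef e e0].
have [g0 [Eg fg mg]] := dense_periodic_maximizer A M_compact phi0_continuous Ef e0.
by exists g0.
Qed.
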